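(* Let $d\ge 1$, $D=\{1,\dots,d\}$, let $B\subset D$ be nonempty, and let $B'=D\setminus B$. Let $L_Q(\mathbb{T}^d)$ be an Orlicz space (generated by a Young function $Q$) such that $$L_Q(\mathbb{T}^d)\nsubseteq L\log^{|B|}L(\mathbb{T}^d).$$ Then: a) $$\sup_{n}\left\|L_{n(B)}\circ R_{n(B')}\right\|_{L_Q(\mathbb{T}^d)\to L_1(\mathbb{T}^d)}=\infty,$$ where the supremum is over natural numbers $n$ and the norm is the operator norm of $f\mapsto (L_{n(B)}\circ R_{n(B')})(f)$ from $L_Q(\mathbb{T}^d)$ to $L_1(\mathbb{T}^d)$; b) there exists a function $f\in L_Q(\mathbb{T}^d)$ such that $\left(L_{n(B)}\circ R_{n(B')}\right)(f)$ does not converge to $f$ in $L_1(\mathbb{T}^d)$-norm as $n\to\infty$.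
   Context: $\mathbb{T}^d=[-\pi,\pi)^d$ with Lebesgue measure; functions on $\mathbb{T}^d$ are measurable and are regarded as $2\pi$-periodic in each variable. $\|f\|_{L_1(\mathbb{T}^d)}=\int_{\mathbb{T}^d}|f|$. $|B|$ is the number of elements of $B$. Fourier coefficients and rectangular partial sums: for $f\in L_1(\mathbb{T}^d)$, $$\widehat f(k_1,\dots,k_d)=\frac1{(2\pi)^d}\int_{\mathbb{T}^d}f(\mathbf{x})e^{-i(k_1x_1+\cdots+k_dx_d)}\,d\mathbf{x},$$ $$S_{N_1,\dots,N_d}(f;\mathbf{x})=\sum_{k_1=-N_1}^{N_1}\cdots\sum_{k_d=-N_d}^{N_d}\widehat f(k_1,\dots,k_d)e^{i(k_1x_1+\cdots+k_dx_d)}.$$ Mixed logarithmic means: let $l_n=\sum_{k=0}^n\frac1{k+1}$. For natural numbers $n_1,\dots,n_d$, $$\left(L_{n_B}\circ R_{n_{B'}}\right)(f;\mathbf{x})=\frac1{\prod_{j\in D}l_{n_j}}\sum_{i_1=0}^{n_1}\cdots\sum_{i_d=0}^{n_d}\frac{S_{m_1,\dots,m_d}(f;\mathbf{x})}{\prod_{j\in D}(i_j+1)},\qquad m_j=\begin{cases}n_j-i_j,& j\in B,\\ i_j,& j\in B'.\end{cases}$$ (That is, Nörlund logarithmic means in the variables indexed by $B$ and Riesz logarithmic means in the variables indexed by $B'$.) For a natural number $n$, $n(B)=(n,\dots,n)\in\mathbb{R}^{|B|}$ and $n(B')=(n,\dots,n)\in\mathbb{R}^{|B'|}$, so $L_{n(B)}\circ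 R_{n(B')}$ is the mixed logarithmic means operator $L_{n_B}\circ R_{n_{B'}}$ with $n_1=\cdots=n_d=n$, i.e. $$\left(L_{n(B)}\circ R_{n(B')}\right)(f;\mathbf{x})=\frac1{l_n^{d}}\sum_{i_1=0}^{n}\cdots\sum_{i_d=0}^{n}\frac{S_{m_1,\dots,m_d}(f;\mathbf{x})}{\prod_{j\in D}(i_j+1)},\qquad m_j=\begin{cases}n-i_j,& j\in B,\\ i_j,& j\in B'.\end{cases}$$ Orlicz spaces: a Young function $Q$ is a convex continuous even function with $Q(0)=0$, $\lim_{u\to+\infty}Q(u)/u=+\infty$, $\lim_{u\to0}Q(u)/u=0$. The Orlicz space $L_Q(\mathbb{T}^d)$ consists of the measurable $f$ with finite norm $\|f\|_{L_Q}=\inf\{k>0:\int_{\mathbb{T}^d}Q(|f|/k)\le1\}$. For $r=1,2,\dots$, $L\log^rL(\mathbb{T}^d)$ is the Orlicz space with $Q(u)=u\log^r(1+u)$, $u>0$. *)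

(* Defs.v *)
From HB Require Import structures.
From mathcomp Require Import all_boot all_order all_algebra.
From mathcomp Require Import complex.
From mathcomp Require Import all_classical all_reals all_analysis.

Set Implicit Arguments.
Unset Strict Implicit.
Unset Printing Implicit Defensive.

Import Order.TTheory GRing.Theory Num.Theory.
Import numFieldNormedType.Exports.

Local Open Scope classical_set_scope.
Local Open Scope complex_scope.
Local Open Scope ring_scope.

Section lebesgue_tuple.
Context {R : realType}.

Definition tuple_cons d (p : measurableTypeR R * d.-tuple R) : d.+1.-tuple R :=
  [tuple of p.1 :: p.2].

(* Lebesgue measure on the Borel sets of R^d, built by recursion on d; see
   lebesgue_tuple_box for its characteristic property. *)
Fixpoint lebesgue_tuple d : set (d.-tuple R) -> \bar R :=
  match d with
  | 0 => dirac [tuple]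
  | d'.+1 => pushforward (lebesgue_measure \x @lebesgue_tuple d')%E
               (@tuple_cons d')
  end.

Lemma measurable_tuple_cons d : measurable_fun setT (@tuple_cons d).
Proof. exact: measurable_cons. Qed.

Lemma measurable_tuple_uncons d :
  measurable_fun setT (fun t : d.+1.-tuple R => (thead t, [tuple of behead t])).
Proof.
apply: measurable_fun_pair => /=; first exact: measurable_tnth.
exact: measurable_behead.
Qed.

Lemma tuple_consK d :
  cancel (@tuple_cons d) (fun t => (thead t, [tuple of behead t])).
Proof. by case=> x t; congr pair; apply/val_inj. Qed.

Let lebesgue_tuple_sigma_finite d :
  exists m : {sigma_finite_measure set (d.-tuple R) -> \bar R},
    @lebesgue_tuple d = m :> (_ -> _).
Proof.
elim: d => [|d [m /= ->]]; first by exists (dirac [tuple]).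
pose l := lebesgue_measure :
  {sigma_finite_measure set (measurableTypeR R) -> \bar R}.
pose mu := (l \x m)%E :
  {measure set (measurableTypeR R * d.-tuple R)%type -> \bar R}.
have [nu nuE] : exists nu : {measure set (d.+1.-tuple R) -> \bar R},
    pushforward mu (@tuple_cons d) = nu :> (_ -> _).
  by unshelve eexists (pushforward mu (@tuple_cons d));
    first exact: measurable_tuple_cons.
rewrite nuE; have sf : sigma_finite setT nu.
  have /sigma_finiteP[F [FT ndF Foo]] := sigma_finiteT l.
  have /sigma_finiteP[G [GT ndG Goo]] := sigma_finiteT m.
  pose u (t : d.+1.-tuple R) : measurableTypeR R * d.-tuple R :=
    (thead t, [tuple of behead t]).
  exists (fun i => u @^-1` (F i `*` G i)).
    rewrite -preimage_bigcup (_ : \bigcup_i _ = setT) ?preimage_setT//.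
    apply/seteqP; split=> // -[x y] _.
    have [i _ Fx] : (\bigcup_i F i) x by rewrite -FT.
    have [j _ Gy] : (\bigcup_i G i) y by rewrite -GT.
    exists (maxn i j) => //; split.
    - by move: x Fx; exact/subsetPset/ndF/leq_maxl.
    - by move: y Gy; exact/subsetPset/ndG/leq_maxr.
  move=> i; have [mF Fi] := Foo i; have [mG Gi] := Goo i; split.
    rewrite -[X in measurable X]setTI.
    by apply: measurable_tuple_uncons => //; exact: measurableX.
  rewrite -nuE /pushforward -comp_preimage.
  rewrite (_ : _ \o _ = id); last first.
    by apply/funext => p /=; exact: tuple_consK.
  by rewrite /mu /= product_measure1E// lte_mul_pinfty// ge0_fin_numE.
pose sfin := isSFinite.Build _ _ _ _ (sfinite_measure_sigma_finite sf).
pose sigf := isSigmaFinite.Build _ _ _ _ sf.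
pose nu' := HB.pack_for (SigmaFiniteMeasure.type (d.+1.-tuple R) R)
  (Measure.sort nu) sfin sigf.
by exists nu'.
Qed.

Let lebesgue_tuple0 d : @lebesgue_tuple d set0 = 0%E.
Proof. by have [m ->] := lebesgue_tuple_sigma_finite d; exact: measure0. Qed.

Let lebesgue_tuple_ge0 d A : (0 <= @lebesgue_tuple d A)%E.
Proof. by have [m ->] := lebesgue_tuple_sigma_finite d. Qed.

Let lebesgue_tuple_semi_sigma_additive d :
  semi_sigma_additive (@lebesgue_tuple d).
Proof.
have [m ->] := lebesgue_tuple_sigma_finite d.
exact: measure_semi_sigma_additive.
Qed.

HB.instance Definition _ d := isMeasure.Build _ _ _ (@lebesgue_tuple d)
  (@lebesgue_tuple0 d) (@lebesgue_tuple_ge0 d)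
  (@lebesgue_tuple_semi_sigma_additive d).

Let lebesgue_tuple_sigma_finiteT d : sigma_finite setT (@lebesgue_tuple d).
Proof.
by have [m ->] := lebesgue_tuple_sigma_finite d; exact: sigma_finiteT.
Qed.

HB.instance Definition _ d := Measure_isSigmaFinite.Build _ _ _
  (@lebesgue_tuple d) (@lebesgue_tuple_sigma_finiteT d).

Lemma lebesgue_tuple_box d (A : 'I_d -> set (measurableTypeR R)) :
  (forall j, measurable (A j)) ->
  lebesgue_tuple [set x : d.-tuple R | forall j, A j (tnth x j)] =
  (\prod_(j < d) lebesgue_measure (A j))%E.
Proof.
elim: d A => [|d IH] A mA.
  rewrite big_ord0 /= diracE mem_set// => -[]//.
rewrite big_ord_recl /= -IH; last by move=> j; exact: mA.
rewrite /pushforward.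
set B := [set x : d.-tuple R | _].
rewrite (_ : _ @^-1` _ = A ord0 `*` B); last first.
  apply/seteqP; split=> -[x t] /= H.
    split=> [|j]; first exact: (H ord0).
    by have := H (lift ord0 j); rewrite tnthS.
  case: H => H0 HB j.
  by case: (unliftP ord0 j) => [k|] -> //=; rewrite tnthS; exact: HB.
rewrite (product_measure1E lebesgue_measure (@lebesgue_tuple d))//.
rewrite /B (_ : [set x | _] = \bigcap_(j in [set: 'I_d])
   ((fun x : d.-tuple R => tnth x j) @^-1` A (lift ord0 j))); last first.
  by apply/seteqP; split=> x /= H j; [move=> _|]; exact: H.
apply: fin_bigcap_measurable => // j _.
rewrite -[X in measurable X]setTI.
by apply: measurable_tnth => //; exact: mA.
Qed.

End lebesgue_tuple.

Section torus.
Context {R : realType} {d : nat}.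
Implicit Types (f g : d.-tuple R -> R[i]) (x : d.-tuple R).

Definition torus : set (d.-tuple R) :=
  [set x | forall j, tnth x j \in `[- pi, pi[].

(* R[i] carries no sigma-algebra, so measurability is that of both parts. *)
Definition cmeasurable f :=
  measurable_fun torus (fun x => complex.Re (f x)) /\
  measurable_fun torus (fun x => complex.Im (f x)).

Definition cintegral f : R[i] :=
  (\int[@lebesgue_tuple R d]_(x in torus) complex.Re (f x)) +i*
  (\int[@lebesgue_tuple R d]_(x in torus) complex.Im (f x)).

Definition norm_L1 f : \bar R :=
  \int[@lebesgue_tuple R d]_(x in torus) (ComplexField.Normc.normc (f x))%:E.

(* e^(it); there is no complex exponential in the library *)
Definition cis (t : R) : R[i] := cos t +i* sin t.

Definition dotp (k : 'I_d -> int) x : R := \sum_(j < d) (k j)%:~R * tnth x j.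

Definition fourier_coef f (k : 'I_d -> int) : R[i] :=
  ((2 * pi) ^- d)%:C * cintegral (fun x => f x * cis (- dotp k x)).

(* The index k j ranges over {0, ..., 2 N_j} and is shifted to the frequency
   k j - N_j, which ranges over {- N_j, ..., N_j}. *)
Definition partial_sum (N : 'I_d -> nat) f x : R[i] :=
  \sum_(k : {dffun forall j : 'I_d, 'I_(N j).*2.+1})
    let freq j := (k j)%:Z - (N j)%:Z in
    fourier_coef f freq * cis (dotp freq x).

Definition log_weight (n : nat) : R := \sum_(0 <= k < n.+1) k.+1%:R^-1.

(* Nörlund logarithmic means in the variables of B, Riesz logarithmic means
   in the others *)
Definition mixed_log_mean (B : {set 'I_d}) (n : 'I_d -> nat) f x : R[i] :=
  ((\prod_(j < d) log_weight (n j))^-1)%:C *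
  \sum_(i : {dffun forall j : 'I_d, 'I_(n j).+1})
    ((\prod_(j < d) (i j).+1%:R)^-1)%:C *
    partial_sum (fun j => if j \in B then n j - i j else i j)%N f x.

Definition diag_log_mean (B : {set 'I_d}) (n : nat) f : d.-tuple R -> R[i] :=
  mixed_log_mean B (fun=> n) f.

Record young_function (Q : R -> R) : Prop := YoungFunction {
  young_convex : convex_function [set: convex_lmodType R^o] Q;
  young_continuous : continuous Q;
  young_even : forall u, Q (- u) = Q u;
  young0 : Q 0 = 0;
  young_pinfty : Q u / u @[u --> +oo] --> +oo;
  young_cvg0 : Q u / u @[u --> 0^'] --> 0 }.

(* Luxemburg norm; it is +oo when no k is admissible *)
Definition orlicz_norm (Q : R -> R) f : \bar R :=
  ereal_inf [set k%:E | k in [set k : R | 0 < k /\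
    (\int[@lebesgue_tuple R d]_(x in torus)
       (Q (ComplexField.Normc.normc (f x) / k))%:E <= 1)%E]].

Definition orlicz_space (Q : R -> R) : set (d.-tuple R -> R[i]) :=
  [set f | cmeasurable f /\ (orlicz_norm Q f < +oo)%E].

Definition LlogL_young (r : nat) (u : R) : R := `|u| * ln (1 + `|u|) ^+ r.

Definition LlogL (r : nat) : set (d.-tuple R -> R[i]) :=
  orlicz_space (LlogL_young r).

Definition operator_norm (Q : R -> R)
    (T : (d.-tuple R -> R[i]) -> d.-tuple R -> R[i]) : \bar R :=
  ereal_sup [set norm_L1 (T f) | f in
    [set f | orlicz_space Q f /\ (orlicz_norm Q f <= 1)%E]].

End torus.

(* Main.v *)
Require Import Defs.
From HB Require Import structures.
From mathcomp Require Import all_boot all_order all_algebra.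
From mathcomp Require Import complex zify ring lra.
From mathcomp Require Import all_classical all_reals all_analysis.
From mathcomp Require Import measurable_realfun.

Set Implicit Arguments.
Unset Strict Implicit.
Unset Printing Implicit Defensive.

Import Order.TTheory GRing.Theory Num.Theory.
Import numFieldNormedType.Exports.

Local Open Scope classical_set_scope.
Local Open Scope complex_scope.
Local Open Scope ring_scope.

(** Both assertions follow from a single function f, of Orlicz norm at most 1,
    whose means have unbounded L_1 norms along a sequence of orders.

    Lower bound by duality. In each variable the means are convolutions with a
    real kernel (log_kernel), the average with weights 1/((i+1) l_n) of the
    Dirichlet kernels of orders n - i (in the variables of B) or i (in the
    others). In the variables of B this kernel is tested against the bounded
    function phi_n(t) = (-1)^n t sin((n+1)t), which multiplies the frequency m,
    for |m| <= n, by pi (-1)^m (1/(n+1+m) + 1/(n+1-m)). Since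
    (-1)^m cos(my) = cos(m(y+pi)), the dual kernel
    y |-> int phi_n(t) log_kernel(t-y) dt is a cosine polynomial in y + pi with
    positive coefficients. Hence it is at least (cos 1) l_n for
    0 <= y + pi <= 1/n (dual_kernel_ge), where all its terms are positive,
    while its L_1 norm is bounded independently of n
    (integral_norm_dual_kernel), because by Parseval's identity it is an
    average of polynomials that are bounded in L_2. In the other variables the
    test function is 1 and the dual kernel is 2 pi. Fubini's theorem on the
    torus turns this into norm_L1_log_mean_ge: up to a constant, the L_1 norm
    of the means of f is at least |int f K_n|, where K_n is the product of the
    dual kernels. So K_n is at least (cos 1)^d l_n^|B| on the cube of side 1/n
    at the corner (-pi, ..., -pi), and it is bounded in L_1.

    Growth gap. If L_Q is not contained in L log^r L then, for every C, there
    are arbitrarily large v such that C Q(v) < v ln^r(1+v)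
    (orlicz_growth_gap).

    Gliding hump. With r = |B|, heights v_k and integers N_k with N_k^d
    comparable to 2^(k+1) Q(v_k) are chosen one after the other
    (hump_sequence), and f is equal to v_k on the cube of side 1/N_k minus the
    cube of side 1/N_(k+1). Then int Q(f) <= sum_k 2^-(k+1) = 1. In the pairing
    of f with K_(N_k) the k-th piece contributes at least a constant times
    v_k (l_(N_k))^r / N_k^d, hence at least a constant times
    2^-k v_k ln^r(1+v_k) / Q(v_k), and the complement of the k-th cube, where
    f <= v_(k-1), costs at most a constant times v_(k-1). As v_k is chosen
    after v_(k-1), the growth gap makes the difference as large as desired. *)

(** * Integrals of real functions *)

Section integral_tools.
Context d (T : measurableType d) (R : realType).
Variable mu : {measure set T -> \bar R}.

Lemma bounded_integrable (D : set T) (f : T -> R) (M : R) :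
  measurable D -> (mu D < +oo)%E -> measurable_fun D f ->
  (forall x, D x -> `|f x| <= M) -> mu.-integrable D (EFin \o f).
Proof.
move=> mD fD mf fM; apply: measurable_bounded_integrable => //.
exists M; split; first exact: num_real.
by move=> N MN x Dx; apply: le_trans (ltW MN); exact: fM.
Qed.

Lemma integrable_sumr (D : set T) (I : Type) (s : seq I) (f : I -> T -> R) :
  measurable D -> (forall i, mu.-integrable D (EFin \o f i)) ->
  mu.-integrable D (EFin \o (fun x => \sum_(i <- s) f i x)).
Proof.
move=> mD fi; elim: s => [|i s IH].
  by under eq_fun do rewrite big_nil; exact: integrable0.
under eq_fun do rewrite big_cons.
exact: (integrableD mD (fi i) IH).
Qed.

Lemma Rintegral_sum (D : set T) (I : Type) (s : seq I) (f : I -> T -> R) :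
  measurable D -> (forall i, mu.-integrable D (EFin \o f i)) ->
  \int[mu]_(x in D) (\sum_(i <- s) f i x) =
  \sum_(i <- s) \int[mu]_(x in D) f i x.
Proof.
move=> mD fi; elim: s => [|i s IH].
  under eq_Rintegral do rewrite big_nil.
  by rewrite big_nil Rintegral_cst// mul0r.
under eq_Rintegral do rewrite big_cons.
by rewrite big_cons RintegralD// ?IH//; exact: integrable_sumr.
Qed.

Lemma integrable_mul_bounded (D : set T) (f h : T -> R) (M : R) :
  measurable D -> mu.-integrable D (EFin \o f) -> measurable_fun D h ->
  (forall x, D x -> `|h x| <= M) ->
  mu.-integrable D (EFin \o (fun x => f x * h x)).
Proof.
move=> mD fi mh hM.
apply: (@le_integrable _ _ _ _ _ mD _ (fun y => (M * f y)%:E)).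
- apply/measurable_EFinP; apply: measurable_funM => //.
  by apply/measurable_EFinP; exact: measurable_int fi.
- move=> y yD; rewrite lee_fin !normrM mulrC; apply: ler_wpM2r => //.
  by apply: le_trans (ler_norm M); exact: hM.
- exact: (integrableZl mD _ fi).
Qed.

End integral_tools.

(** * Trigonometric integrals over a period *)

Section circle.
Context {R : realType}.
Notation mu := (@lebesgue_measure R).

(** One period of the circle, as a Borel set of the real line; the torus is its
    d-th power. *)
Definition circle : set (measurableTypeR R) := `[- pi, pi[%classic.
Local Notation J := circle.

Lemma measurable_circle : measurable J.
Proof. exact: measurable_itv. Qed.

Lemma circleP (t : R) : J t = (- pi <= t < pi).
Proof. by rewrite /circle /= in_itv. Qed.

Lemma lebesgue_circle : mu J = (2 * pi : R)%:E.
Proof.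
rewrite /circle lebesgue_measure_itv /= lte_fin.
have p0 := pi_gt0 R.
rewrite ifT; last by lra.
by rewrite -EFinB; congr EFin; lra.
Qed.

Lemma lebesgue_circle_fin : (mu J < +oo)%E.
Proof. by rewrite lebesgue_circle ltry. Qed.

Lemma Rintegral_circle_cst (c : R) : \int[mu]_(t in J) c = c * (2 * pi).
Proof.
rewrite Rintegral_cst; last exact: measurable_circle.
by congr (_ * _); rewrite -[LHS]/(fine (mu J)) lebesgue_circle.
Qed.

Lemma continuous_integrable_cc (f : R -> R) : continuous f ->
  mu.-integrable `[- pi, pi] (EFin \o f).
Proof.
move=> cf; apply: continuous_compact_integrable; first exact: segment_compact.
by apply: continuous_subspaceT => x; exact: cf.
Qed.

Lemma continuous_integrable_circle (f : R -> R) : continuous f ->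
  mu.-integrable J (EFin \o f).
Proof.
move=> /continuous_integrable_cc; apply: integrableS.
- exact: measurable_itv.
- exact: measurable_circle.
by apply: subset_itvl; rewrite bnd_simp.
Qed.

Lemma integral_circle_FTC (f F : R -> R) : continuous f ->
  (forall x : R, is_derive x (1 : R) F (f x)) ->
  \int[mu]_(t in J) f t = F pi - F (- pi).
Proof.
move=> cf dF; rewrite Rintegral_itv_bndo_bndc; last first.
  exact: continuous_integrable_circle.
have cF : continuous F.
  move=> x; apply/differentiable_continuous/derivable1_diffP.
  by have [] := dF x.
rewrite /Rintegral (@continuous_FTC2 _ f F)//.
- by have := pi_gt0 R; lra.
- by apply: continuous_subspaceT => x; exact: cf.
- split.
  + by move=> x _; have [] := dF x.
  + by apply: cvg_at_right_filter; exact: cF.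
  + by apply: cvg_at_left_filter; exact: cF.
- by move=> x _; rewrite derive1E; have [] := dF x.
Qed.

Lemma sin_zpi (c : int) : sin (c%:~R * pi) = 0 :> R.
Proof.
suff H n : sin (n%:R * pi) = 0 :> R.
  case: c => n; first exact: H.
  by rewrite NegzE mulrNz mulNr sinN -[_%:~R]/(n.+1%:R) H oppr0.
elim: n => [|n IH]; first by rewrite mul0r sin0.
by rewrite -natr1 mulrDl mul1r sinDpi IH oppr0.
Qed.

Lemma cos_zpiD (c : int) (x : R) :
  cos (c%:~R * pi + x) = cos (c%:~R * pi) * cos x.
Proof. by rewrite cosD sin_zpi mul0r subr0. Qed.

Lemma sin_zpiD (c : int) (x : R) :
  sin (c%:~R * pi + x) = cos (c%:~R * pi) * sin x.
Proof. by rewrite sinD sin_zpi mul0r add0r. Qed.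

Lemma cos_zpiND (c : int) (x : R) :
  cos (c%:~R * - pi + x) = cos (c%:~R * pi) * cos x.
Proof. by rewrite mulrN -mulNr -mulrNz cos_zpiD mulrNz mulNr cosN. Qed.

Lemma sin_zpiND (c : int) (x : R) :
  sin (c%:~R * - pi + x) = cos (c%:~R * pi) * sin x.
Proof. by rewrite mulrN -mulNr -mulrNz sin_zpiD mulrNz mulNr cosN. Qed.

Lemma cos_zpi_sqr (c : int) : cos (c%:~R * pi) ^+ 2 = 1 :> R.
Proof. by rewrite cos2sin2 sin_zpi expr0n subr0. Qed.

Lemma continuous_affine (c x : R) : continuous (fun t : R => c * t + x).
Proof.
move=> t; apply: (@continuousD _ R^o _ (fun t : R => c * t) (fun=> x)) => //.
  exact: mulrl_continuous.
exact: cst_continuous.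
Qed.

Lemma continuous_cos_affine (c x : R) : continuous (fun t : R => cos (c * t + x)).
Proof.
move=> t; apply: (@continuous_comp _ _ _ (fun t : R => c * t + x) (@cos R)).
  exact: continuous_affine.
exact: continuous_cos.
Qed.

Lemma continuous_sin_affine (c x : R) : continuous (fun t : R => sin (c * t + x)).
Proof.
move=> t; apply: (@continuous_comp _ _ _ (fun t : R => c * t + x) (@sin R)).
  exact: continuous_affine.
exact: continuous_sin.
Qed.

Lemma integral_circle_cos (c : int) (x : R) :
  \int[mu]_(t in J) cos (c%:~R * t + x) = if c == 0 then 2 * pi * cos x else 0.
Proof.
have [->|c0] := eqVneq c 0.
  under eq_Rintegral do rewrite mul0r add0r.
  by rewrite Rintegral_circle_cst mulrC.
have c0' : c%:~R != 0 :> R by rewrite intr_eq0.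
have dF (t : R) : is_derive t (1 : R) (fun t => sin (c%:~R * t + x) / c%:~R)
    (cos (c%:~R * t + x)).
  apply: is_derive_eq.
  rewrite /GRing.scale /=; field; exact: c0'.
rewrite (integral_circle_FTC (@continuous_cos_affine _ _) dF).
by rewrite sin_zpiND sin_zpiD subrr.
Qed.

Lemma integral_circle_idsin (c : int) (x : R) : c != 0 ->
  \int[mu]_(t in J) (t * sin (c%:~R * t + x)) =
  - (2 * pi * cos (c%:~R * pi) * cos x / c%:~R).
Proof.
move=> c0; have c0' : c%:~R != 0 :> R by rewrite intr_eq0.
have cf : continuous (fun t : R => t * sin (c%:~R * t + x)).
  move=> t; apply: continuousM; first exact: cvg_id.
  exact: continuous_sin_affine.
have dF (t : R) : is_derive t (1 : R)
    (fun t => - (t * cos (c%:~R * t + x) / c%:~R)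
              + sin (c%:~R * t + x) / c%:~R ^+ 2)
    (t * sin (c%:~R * t + x)).
  apply: is_derive_eq.
  by rewrite /GRing.scale /=; field.
rewrite (integral_circle_FTC cf dF).
by rewrite !sin_zpiND !cos_zpiND !sin_zpiD !cos_zpiD; field.
Qed.

End circle.

(** * Logarithmic weights *)

Section sums.
Context {R : realType}.

(** The square of a sum of nonnegative numbers is at most twice its upper
    triangular part, diagonal included. *)
Lemma sqr_sum_le (a : nat -> R) (n : nat) : (forall i, 0 <= a i) ->
  (\sum_(i < n) a i) ^+ 2 <=
  2 * \sum_(i < n) (a i * \sum_(i <= p < n) a p).
Proof.
move=> a0; elim: n => [|n IH]; first by rewrite !big_ord0 expr0n mulr0.
rewrite !big_ord_recr /= big_nat1.
have -> : \sum_(i < n) a i * \sum_(i <= p < n.+1) a p =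
    \sum_(i < n) a i * \sum_(i <= p < n) a p + (\sum_(i < n) a i) * a n.
  rewrite mulr_suml -big_split /=; apply: eq_bigr => i _.
  by rewrite big_nat_recr ?mulrDr//= ltnW.
have := sqr_ge0 (a n); move: IH.
set A := \sum_(i < n) a i; set S := \sum_(i < n) _; nra.
Qed.

Lemma sum_inv_sqr_le (n : nat) : \sum_(k < n) (k.+1%:R ^- 2 : R) <= 2.
Proof.
(* The stronger bound 2 - 1/(n+1) is inductive. *)
suff H : \sum_(k < n.+1) (k.+1%:R ^- 2 : R) <= 2 - n.+1%:R^-1.
  move: H; rewrite big_ord_recr /=.
  have h2 : 0 <= (n.+1%:R ^- 2 : R) by rewrite invr_ge0 exprn_ge0.
  have h1 : 0 <= (n.+1%:R ^-1 : R) by rewrite invr_ge0.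
  move=> H; apply: le_trans (le_trans H _); first by rewrite lerDl.
  by rewrite gerBl.
elim: n => [|n IH].
  by rewrite big_ord_recr big_ord0 /= mulr1n expr1n invr1 add0r; lra.
rewrite big_ord_recr /=; apply: le_trans (lerD IH (lexx _)) _.
have n0 : (0 : R) < n.+1%:R by rewrite ltr0n.
rewrite -(natr1 n.+1); move: n0; set x := n.+1%:R => x0.
rewrite -subr_ge0 (_ : _ - _ = (x * (x + 1) ^+ 2)^-1); last by field; lra.
by rewrite invr_ge0 mulr_ge0 ?exprn_ge0//; lra.
Qed.

Lemma log_weightE (n : nat) : log_weight n = \sum_(i < n.+1) (i.+1%:R^-1 : R).
Proof. by rewrite /log_weight big_mkord. Qed.

Lemma log_weight_gt0 (n : nat) : 0 < log_weight n :> R.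
Proof.
rewrite log_weightE big_ord_recl /= ltr_pwDl ?invr_gt0//.
by apply: sumr_ge0 => i _; rewrite invr_ge0.
Qed.

(** The weights 1/((i+1) l_n) add up to 1, so that averages of bounds are
    bounds. *)
Lemma log_weight_mean (n : nat) (a : R) :
  (log_weight n)^-1 * \sum_(i < n.+1) (i.+1%:R^-1 * a) = a.
Proof. by rewrite -mulr_suml -log_weightE mulKf// gt_eqF// log_weight_gt0. Qed.

End sums.

(** * Kernels and test functions in one variable *)

Section kernels.
Context {R : realType}.
Notation mu := (@lebesgue_measure R).
Local Notation J := (@circle R).

(** The Dirichlet kernel of order N. As in the definition of the partial sums,
    the index k stands for the frequency k - N. *)
Definition dirichlet (N : nat) (t : R) : R :=
  \sum_(k < N.*2.+1) cos ((k%:Z - N%:Z)%:~R * t).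

(** The kernel of the logarithmic means of order n in one variable: of
    Noerlund type when b holds, of Riesz type otherwise. *)
Definition log_kernel (b : bool) (n : nat) (t : R) : R :=
  (log_weight n)^-1 *
  \sum_(i < n.+1) (i.+1%:R^-1 * dirichlet (if b then n - i else i)%N t).

(** The function against which log_kernel is tested; the factor
    cos (n pi) is the sign (-1)^n. For means of Riesz type it is constant. *)
Definition test_fun (b : bool) (n : nat) (t : R) : R :=
  if b then cos (n%:Z%:~R * pi) * (t * sin (n.+1%:Z%:~R * t)) else 1.

(** The pairing of test_fun with the translates of log_kernel. *)
Definition dual_kernel (b : bool) (n : nat) (y : R) : R :=
  \int[mu]_(t in J) (test_fun b n t * log_kernel b n (t - y)).

(** The number 1/(n+1+m) + 1/(n+1-m) for n = N + i and for the frequency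
    m = k - N, which satisfies |m| <= N; both denominators are positive. *)
Definition dual_coef (i N k : nat) : R :=
  (i + k).+1%:R^-1 + (i + (N.*2 - k)).+1%:R^-1.

(** The contribution of the Dirichlet kernel of order N to the dual kernel of
    order N + i, up to the factor pi. *)
Definition dual_sum (i N : nat) (y : R) : R :=
  \sum_(k < N.*2.+1) dual_coef i N k * cos ((k%:Z - N%:Z)%:~R * (y + pi)).

Lemma continuous_sumr (I : Type) (s : seq I) (f : I -> R -> R) :
  (forall i, continuous (f i)) -> continuous (fun x => \sum_(i <- s) f i x).
Proof.
move=> cf x; elim: s => [|i s IH].
  by under eq_fun do rewrite big_nil; exact: cst_continuous.
under eq_fun do rewrite big_cons.
by apply: continuousD => //; exact: cf.
Qed.

Lemma continuous_cstM (c : R) (f : R -> R) :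
  continuous f -> continuous (fun x => c * f x).
Proof.
by move=> cf x; apply: continuousM; [exact: cst_continuous|exact: cf].
Qed.

Lemma continuous_normr (f : R -> R) :
  continuous f -> continuous (fun x => `|f x|).
Proof.
move=> cf x; apply: (@continuous_comp _ _ _ f (fun y => `|y|)); first exact: cf.
exact: norm_continuous.
Qed.

Lemma continuous_dirichlet (N : nat) (y : R) :
  continuous (fun t => dirichlet N (t - y)).
Proof.
apply: continuous_sumr => k.
under eq_fun do rewrite mulrBr.
exact: continuous_cos_affine.
Qed.

Lemma continuous_log_kernel b n (y : R) :
  continuous (fun t => log_kernel b n (t - y)).
Proof.
apply: continuous_cstM; apply: continuous_sumr => i.
exact/continuous_cstM/continuous_dirichlet.
Qed.

Lemma continuous_test_fun b n : continuous (test_fun b n).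
Proof.
case: b; last exact: cst_continuous.
have cs : continuous (fun t : R => sin (n.+1%:Z%:~R * t)).
  rewrite (_ : (fun _ => _) = fun t : R => sin (n.+1%:Z%:~R * t + 0)).
    exact: continuous_sin_affine.
  by apply/funext => t; rewrite addr0.
apply: continuous_cstM => t; apply: continuousM; [exact: cvg_id|exact: cs].
Qed.

Lemma continuous_dual_sum i N : continuous (dual_sum i N).
Proof.
apply: continuous_sumr => k; apply: continuous_cstM.
under eq_fun do rewrite mulrDr.
exact: continuous_cos_affine.
Qed.

Lemma norm_test_fun b n (t : R) : J t -> `|test_fun b n t| <= pi.
Proof.
have p2 := pi_ge2 R; case: b => /=; last by rewrite normr1; lra.
rewrite circleP => /andP[t1 t2].
have t3 : `|t| <= pi by rewrite ler_norml; lra.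
rewrite !normrM -[X in _ <= X]mul1r ler_pM// ?mulr_ge0 ?cos_max//.
by rewrite -[X in _ <= X]mulr1 ler_pM// sin_max.
Qed.

(** Testing a single frequency. The product t sin(at) cos(m(t-y)), with
    a = N + i + 1, is half the sum of two functions t sin((a+m)t - my) and
    t sin((a-m)t + my), and a + m and a - m are positive integers. *)
Lemma integral_test_cos (i N k : nat) (y : R) : (k < N.*2.+1)%N ->
  \int[mu]_(t in J)
    (test_fun true (N + i) t * cos ((k%:Z - N%:Z)%:~R * (t - y))) =
  pi * (dual_coef i N k * cos ((k%:Z - N%:Z)%:~R * (y + pi))).
Proof.
move=> kN; set m : int := k%:Z - N%:Z; set a : int := (N + i).+1%:Z.
have ap : a + m = (i + k).+1%:Z by rewrite /a /m; lia.
have am : a - m = (i + (N.*2 - k)).+1%:Z by rewrite /a /m; lia.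
pose e := cos ((N + i)%:Z%:~R * pi) : R.
transitivity (\int[mu]_(t in J)
  (e / 2 * (t * sin ((a + m)%:~R * t + (- (m%:~R * y))) +
            t * sin ((a - m)%:~R * t + m%:~R * y)))).
  apply: eq_Rintegral => t _; rewrite /test_fun -/e -/a.
  have -> : (a + m)%:~R * t - m%:~R * y = a%:~R * t + m%:~R * (t - y).
    by rewrite intrD; ring.
  have -> : (a - m)%:~R * t + m%:~R * y = a%:~R * t - m%:~R * (t - y).
    by rewrite intrB; ring.
  by rewrite sinD sinB; field.
have cts c x : mu.-integrable J (EFin \o (fun t : R => t * sin (c * t + x))).
  apply: continuous_integrable_circle => t; apply: continuousM; first exact: cvg_id.
  exact: continuous_sin_affine.
rewrite RintegralZl; [|exact: measurable_circle| ]; last first.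
  exact: (integrableD measurable_circle (cts _ _) (cts _ _)).
rewrite RintegralD; [|exact: measurable_circle|exact: cts|exact: cts].
rewrite !integral_circle_idsin; [|by rewrite am|by rewrite ap].
have ea : cos (a%:~R * pi) = - e.
  by rewrite /a -[_%:~R]/((N + i).+1%:R : R) -natr1 mulrDl mul1r cosDpi.
have ee : e * e = 1 by rewrite -expr2 cos_zpi_sqr.
have cyp : cos (m%:~R * (y + pi)) = cos (m%:~R * pi) * cos (m%:~R * y).
  by rewrite mulrDr addrC cos_zpiD.
have eap : cos ((a + m)%:~R * pi) = - e * cos (m%:~R * pi).
  by rewrite intrD mulrDl cos_zpiD ea.
have eam : cos ((a - m)%:~R * pi) = - e * cos (m%:~R * pi).
  by rewrite intrB mulrBl cos_zpiD cosN ea.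
rewrite eap eam cyp cosN.
rewrite ap am.
rewrite /dual_coef; change ((i + k).+1%:~R : R) with ((i + k).+1%:R : R).
change ((i + (N.*2 - k)).+1%:~R : R) with ((i + (N.*2 - k)).+1%:R : R).
set u : R := (i + k).+1%:R; set v : R := (i + (N.*2 - k)).+1%:R.
have u0 : u != 0 by rewrite pnatr_eq0.
have v0 : v != 0 by rewrite pnatr_eq0.
clearbody u v.
set cy := cos (m%:~R * y); set cm := cos (m%:~R * pi).
(* The sign e = (-1)^n comes in twice: from the test function, and from
   cos((n+1) pi) = - e. *)
rewrite (_ : _ * _ = (e * e) * (pi * cm * cy * (u^-1 + v^-1))).
  by rewrite ee; field; rewrite u0 v0.
by field; rewrite u0 v0.
Qed.

Lemma norm_dirichlet_le (N : nat) (t : R) : `|dirichlet N t| <= N.*2.+1%:R.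
Proof.
apply: le_trans (ler_norm_sum _ _ _) _.
apply: (@le_trans _ _ (\sum_(k < N.*2.+1) 1)).
  by apply: ler_sum => k _; exact: cos_max.
by rewrite sumr_const card_ord.
Qed.

Lemma norm_log_kernel_le b (n : nat) (t : R) : `|log_kernel b n t| <= n.*2.+1%:R.
Proof.
have l0 : 0 < log_weight n :> R by exact: log_weight_gt0.
rewrite normrM ger0_norm ?invr_ge0 ?(ltW l0)// -[leRHS](log_weight_mean n).
apply: ler_wpM2l; first by rewrite invr_ge0 ltW.
apply: le_trans (ler_norm_sum _ _ _) _; apply: ler_sum => i _.
rewrite normrM ger0_norm ?invr_ge0//; apply: ler_wpM2l; first by rewrite invr_ge0.
apply: le_trans (norm_dirichlet_le _ _) _.
rewrite ler_nat ltnS leq_double; case: b; first exact: leq_subr.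
by rewrite -ltnS.
Qed.

End kernels.

(** * Bounds for the dual kernel in one variable *)

Section dual_bounds.
Context {R : realType}.
Notation mu := (@lebesgue_measure R).
Local Notation J := (@circle R).

Lemma dual_kernelT (n : nat) (y : R) :
  dual_kernel true n y =
  (log_weight n)^-1 *
  \sum_(i < n.+1) (i.+1%:R^-1 * (pi * dual_sum i (n - i) y)).
Proof.
have ic (k : int) : mu.-integrable J
    (EFin \o (fun t : R => test_fun true n t * cos (k%:~R * (t - y)))).
  apply: continuous_integrable_circle => t; apply: continuousM.
    exact: continuous_test_fun.
  have := @continuous_cos_affine _ k%:~R (k%:~R * - y) t.
  by under eq_fun do rewrite -mulrDr.
have idn N : mu.-integrable J
    (EFin \o (fun t : R => test_fun true n t * dirichlet N (t - y))).
  apply: continuous_integrable_circle => t; apply: continuousM.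
    exact: continuous_test_fun.
  exact: continuous_dirichlet.
rewrite /dual_kernel /log_kernel.
under eq_Rintegral => t _ do
  rewrite mulrCA mulr_sumr; under eq_Rintegral do under eq_bigr do rewrite mulrCA.
have idn' (i : 'I_n.+1) : mu.-integrable J (EFin \o (fun t : R =>
    i.+1%:R^-1 * (test_fun true n t * dirichlet (n - i) (t - y)))).
  exact: (integrableZl measurable_circle _ (idn _)).
rewrite RintegralZl; [|exact: measurable_circle|]; last first.
  apply: continuous_integrable_circle; apply: continuous_sumr => i.
  apply: continuous_cstM => t; apply: continuousM.
    exact: continuous_test_fun.
  exact: continuous_dirichlet.
rewrite Rintegral_sum; [|exact: measurable_circle|exact: idn'].
congr (_ * _); apply: eq_bigr => i _.
rewrite RintegralZl; [|exact: measurable_circle|exact: idn].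
congr (_ * _); rewrite /dirichlet; under eq_Rintegral do rewrite mulr_sumr.
rewrite Rintegral_sum; [|exact: measurable_circle|by move=> k; exact: ic].
rewrite /dual_sum mulr_sumr; apply: eq_bigr => k _.
rewrite -integral_test_cos// subnK//.
by rewrite -ltnS.
Qed.

Lemma dual_kernelF (n : nat) (y : R) : dual_kernel false n y = 2 * pi.
Proof.
have ic (k : int) : mu.-integrable J
    (EFin \o (fun t : R => cos (k%:~R * (t - y)))).
  apply: continuous_integrable_circle => t.
  have := @continuous_cos_affine _ k%:~R (k%:~R * - y) t.
  by under eq_fun do rewrite -mulrDr.
have idn N : mu.-integrable J (EFin \o (fun t : R => dirichlet N (t - y))).
  by apply: continuous_integrable_circle; exact: continuous_dirichlet.
rewrite /dual_kernel /log_kernel; under eq_Rintegral do rewrite mul1r.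
rewrite RintegralZl; [|exact: measurable_circle|]; last first.
  apply: continuous_integrable_circle; apply: continuous_sumr => i.
  by apply: continuous_cstM; exact: continuous_dirichlet.
rewrite Rintegral_sum; [|exact: measurable_circle|]; last first.
  by move=> i; exact: (integrableZl measurable_circle _ (idn _)).
rewrite -[RHS](log_weight_mean n); congr (_ * _); apply: eq_bigr => i _.
rewrite RintegralZl; [|exact: measurable_circle|exact: idn].
congr (_ * _); rewrite /dirichlet.
rewrite Rintegral_sum; [|exact: measurable_circle|by move=> k; exact: ic].
have im : (i < i.*2.+1)%N by lia.
rewrite (bigD1 (Ordinal im)) //= big1 ?addr0; last first.
  move=> k /eqP/val_eqP /= ki; under eq_Rintegral do rewrite mulrBr.
  by rewrite integral_circle_cos subr_eq0 eqz_nat (negbTE ki).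
under eq_Rintegral do rewrite mulrBr.
by rewrite integral_circle_cos subrr eqxx mul0r oppr0 cos0 mulr1.
Qed.

Lemma continuous_dual_kernel b n : continuous (@dual_kernel R b n).
Proof.
case: b; last first.
  rewrite (_ : dual_kernel _ _ = cst (2 * pi)); first exact: cst_continuous.
  by apply/funext => y; rewrite dual_kernelF.
rewrite (_ : dual_kernel _ _ = fun y => (log_weight n)^-1 *
  \sum_(i < n.+1) (i.+1%:R^-1 * (pi * dual_sum i (n - i) y))); last first.
  by apply/funext => y; rewrite dual_kernelT.
apply: continuous_cstM; apply: continuous_sumr => i.
by do 2 apply: continuous_cstM; exact: continuous_dual_sum.
Qed.

Lemma dual_coef_ge0 (i N k : nat) : 0 <= dual_coef i N k :> R.
Proof. by rewrite addr_ge0// invr_ge0. Qed.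

(** Within 1/N to the right of -pi all the cosines are at least cos 1. The
    first summands of the coefficients at the frequencies m <= 0 already give
    the harmonic sum. *)
Lemma dual_sum_ge (i N : nat) (y : R) : - pi <= y -> N%:R * (y + pi) <= 1 ->
  cos 1 * \sum_(i <= p < (N + i).+1) p.+1%:R^-1 <= dual_sum i N y.
Proof.
move=> y1 y2; have p2 := pi_ge2 R.
have c1 := cos1_gt0 R; have p1 : 1 <= pi :> R by lra.
have cosm (k : 'I_N.*2.+1) : cos 1 <= cos ((k%:Z - N%:Z)%:~R * (y + pi)).
  set x := _ * _; rewrite -[cos x]cos_norm.
  have x1 : `|x| <= 1.
    rewrite normrM [`|y + pi|]ger0_norm; last by lra.
    apply: le_trans y2; apply: ler_wpM2r; first by lra.
    rewrite -intr_norm -[N%:R]/(N%:Z%:~R) ler_int ler_norml.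
    by case: k x => k /= kN _; lia.
  move: x1; rewrite le_eqVlt => /predU1P[->//|x1].
  apply/ltW; rewrite ltr_cos// in_itv /=.
  - by rewrite normr_ge0 (le_trans (ltW x1)).
  - by rewrite ler01 p1.
have le2 : \sum_(i <= p < (N + i).+1) (p.+1%:R^-1 : R) <=
    \sum_(k < N.*2.+1) dual_coef i N k.
  apply: (@le_trans _ _ (\sum_(k < N.*2.+1) (i + k).+1%:R^-1)); last first.
    by apply: ler_sum => k _; rewrite lerDl invr_ge0.
  rewrite -[X in \sum_(X <= _ < _) _]add0n big_addn subSn ?leq_addl// addnK.
  rewrite -(big_mkord xpredT (fun k => (i + k).+1%:R^-1 : R)).
  have NN : (N.+1 <= N.*2.+1)%N by lia.
  rewrite (@big_cat_nat _ _ _ N.+1 0 N.*2.+1) //.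
  under eq_bigr do rewrite addnC.
  by rewrite lerDl; apply: sumr_ge0 => k _; rewrite invr_ge0.
apply: (le_trans (ler_wpM2l (ltW c1) le2)).
rewrite mulr_sumr; apply: ler_sum => k _; rewrite mulrC.
by apply: ler_wpM2l; [exact: dual_coef_ge0|exact: cosm].
Qed.

(** Near the corner the dual kernel of Noerlund type is of order l_n: the
    bounds of the sums dual_sum add up to the upper triangular part of l_n^2,
    which is then divided by l_n; the factor pi >= 2 makes up for the half. *)
Lemma dual_kernel_ge b (n : nat) (y : R) : - pi <= y -> n%:R * (y + pi) <= 1 ->
  cos 1 * (if b then log_weight n else 1) <= dual_kernel b n y.
Proof.
move=> y1 y2; have p2 := pi_ge2 R; have c1 := cos1_gt0 R.
case: b; last first.
  by rewrite dual_kernelF mulr1; have := cos_le1 (1 : R); lra.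
have l0 := log_weight_gt0 n : 0 < log_weight n :> R.
rewrite dual_kernelT ler_pdivlMl//.
apply: (@le_trans _ _ (\sum_(i < n.+1)
    (i.+1%:R^-1 * (2 * (cos 1 * \sum_(i <= p < n.+1) p.+1%:R^-1))))).
  have := @sqr_sum_le R (fun i => i.+1%:R^-1) n.+1 (fun i => _).
  rewrite -log_weightE => /(_ (fun i => ltac:(by rewrite invr_ge0))) H.
  rewrite mulrCA -expr2; apply: le_trans (ler_wpM2l (ltW c1) H) _.
  rewrite !mulr_sumr; apply: ler_sum => i _.
  by rewrite le_eqVlt; apply/orP; left; apply/eqP; ring.
apply: ler_sum => i _; apply: ler_wpM2l; first by rewrite invr_ge0.
have iN : (n - i + i = n)%N by rewrite subnK// -ltnS.
apply: ler_pM => //.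
- by rewrite mulr_ge0 ?(ltW c1)// sumr_ge0// => k _; rewrite invr_ge0.
- rewrite -[in X in \sum_(_ <= _ < X) _]iN; apply: dual_sum_ge => //.
  apply: le_trans y2; apply: ler_wpM2r; first by lra.
  by rewrite ler_nat leq_subr.
Qed.

Lemma sum_dual_coef_sqr_le (i N : nat) :
  \sum_(k < N.*2.+1) (dual_coef i N k ^+ 2 : R) <= 8.
Proof.
pose g k : R := (i + k).+1%:R^-1.
have coefE (k : 'I_N.*2.+1) : dual_coef i N k = g k + g (rev_ord k) by [].
have sg : \sum_(k < N.*2.+1) (g k ^+ 2 : R) <= 2.
  apply: le_trans (sum_inv_sqr_le N.*2.+1); apply: ler_sum => k _.
  rewrite exprVn lef_pV2 ?posrE ?exprn_gt0 ?ltr0n//.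
  by rewrite ler_pXn2r ?nnegrE// ler_nat ltnS leq_addl.
apply: (@le_trans _ _ (\sum_(k < N.*2.+1) (2 * g k ^+ 2 + 2 * g (rev_ord k) ^+ 2))).
  apply: ler_sum => k _; rewrite coefE.
  by have := sqr_ge0 (g k - g (rev_ord k)); set u := g k; set v := g _; nra.
have rg : \sum_(k < N.*2.+1) g (rev_ord k) ^+ 2 = \sum_(k < N.*2.+1) g k ^+ 2.
  by rewrite [RHS](reindex_inj rev_ord_inj).
rewrite big_split -!mulr_sumr /= {}rg.
by move: sg; set S := \sum_(k < _) _; lra.
Qed.

Lemma integral_circle_cos_shift (c : int) :
  \int[mu]_(y in J) cos (c%:~R * (y + pi)) = if c == 0 then 2 * pi else 0.
Proof.
under eq_Rintegral do rewrite mulrDr.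
rewrite integral_circle_cos; case: eqP => // ->.
by rewrite mul0r cos0 mulr1.
Qed.

Lemma continuous_cos_shift (c : int) :
  continuous (fun y : R => cos (c%:~R * (y + pi))).
Proof. by under eq_fun do rewrite mulrDr; exact: continuous_cos_affine. Qed.

(** The identity of Parseval; the squares of the coefficients add up to at most
    8. The cosines at the frequencies m and -m coincide,
    so that each index k is paired both with itself and with its reflection
    rev_ord k. *)
Lemma integral_dual_sum_sqr (i N : nat) :
  \int[mu]_(y in J) dual_sum i N y ^+ 2 <= 16 * pi.
Proof.
have p0 := pi_gt0 R.
pose m k : int := k%:Z - N%:Z.
pose w k : R := dual_coef i N k.
pose h (k l : 'I_N.*2.+1) (y : R) := w k * w l / 2 *
  (cos ((m k - m l)%:~R * (y + pi)) + cos ((m k + m l)%:~R * (y + pi))).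
have ch k l : continuous (h k l).
  apply: continuous_cstM => y.
  by apply: continuousD; exact: continuous_cos_shift.
have -> : \int[mu]_(y in J) dual_sum i N y ^+ 2 =
    \int[mu]_(y in J) (\sum_k \sum_l h k l y).
  apply: eq_Rintegral => y _; rewrite expr2 mulr_suml; apply: eq_bigr => k _.
  rewrite mulr_sumr; apply: eq_bigr => l _.
  rewrite /h.
  have -> : (m k - m l)%:~R * (y + pi) =
      (m k)%:~R * (y + pi) - (m l)%:~R * (y + pi) by rewrite intrB mulrBl.
  have -> : (m k + m l)%:~R * (y + pi) =
      (m k)%:~R * (y + pi) + (m l)%:~R * (y + pi) by rewrite intrD mulrDl.
  by rewrite cosB cosD /w /m; field.
rewrite Rintegral_sum; [|exact: measurable_circle|]; last first.
  by move=> k; apply: continuous_integrable_circle; exact: continuous_sumr.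
have Ih k l : \int[mu]_(y in J) h k l y =
    w k * w l * pi * ((k == l)%:R + (rev_ord k == l)%:R).
  rewrite RintegralZl; [|exact: measurable_circle|]; last first.
    by apply: continuous_integrable_circle => y; apply: continuousD;
      exact: continuous_cos_shift.
  rewrite RintegralD; [|exact: measurable_circle| |]; last 2 first.
  - by apply: continuous_integrable_circle; exact: continuous_cos_shift.
  - by apply: continuous_integrable_circle; exact: continuous_cos_shift.
  rewrite !integral_circle_cos_shift.
  have -> : (m k - m l == 0) = (k == l) by rewrite -val_eqE /= /m; lia.
  have -> : (m k + m l == 0) = (rev_ord k == l).
    rewrite -val_eqE /= /m; have := ltn_ord k; have := ltn_ord l; lia.
  by case: (k == l); case: (_ == l) => /=; field.
under eq_bigr => k _ do (rewrite Rintegral_sum;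
  [|exact: measurable_circle|by move=> l; exact/continuous_integrable_circle/ch];
  under eq_bigr do rewrite Ih).
have wrev (k : 'I_N.*2.+1) : w (rev_ord k) = w k.
  have kN : (k <= N.*2)%N by rewrite -ltnS.
  have rk : rev_ord k = (N.*2 - k)%N :> nat by rewrite /= subSS.
  by rewrite /w /dual_coef rk subKn// addrC.
have -> : \sum_(k < N.*2.+1) \sum_(l < N.*2.+1)
    w k * w l * pi * ((k == l)%:R + (rev_ord k == l)%:R) =
   2 * pi * \sum_(k < N.*2.+1) w k ^+ 2.
  rewrite mulr_sumr; apply: eq_bigr => k _.
  under eq_bigr do rewrite mulrDr; rewrite big_split /=.
  rewrite (bigD1 k)//= big1 ?addr0; last first.
    by move=> l /negbTE; rewrite eq_sym => ->; rewrite mulr0.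
  rewrite (bigD1 (rev_ord k))//= big1 ?addr0; last first.
    by move=> l /negbTE; rewrite eq_sym => ->; rewrite mulr0.
  by rewrite !eqxx wrev /=; ring.
have := sum_dual_coef_sqr_le i N; rewrite -/w; set S := \sum_(k < _) _; nra.
Qed.

Lemma integral_norm_dual_sum (i N : nat) :
  \int[mu]_(y in J) `|dual_sum i N y| <= 9 * pi.
Proof.
have cd := @continuous_dual_sum R i N.
have c2 : continuous (fun y : R => dual_sum i N y ^+ 2).
  rewrite (_ : (fun _ => _) = fun y => dual_sum i N y * dual_sum i N y).
    by move=> y; apply: continuousM; exact: cd.
  by apply/funext => y; rewrite expr2.
(* The bound |z| <= (1 + z^2) / 2 reduces the L_1 norm to the L_2 norm. *)
apply: (@le_trans _ _ (\int[mu]_(y in J) (2^-1 + 2^-1 * dual_sum i N y ^+ 2))).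
  apply: le_Rintegral.
  - exact: measurable_circle.
  - by apply: continuous_integrable_circle; exact: continuous_normr.
  - apply: continuous_integrable_circle => y.
    apply: (@continuousD _ R^o _ (fun=> 2^-1)
      (fun y => 2^-1 * dual_sum i N y ^+ 2)).
      exact: cst_continuous.
    exact: continuous_cstM.
  - move=> y _; have := sqr_ge0 (`|dual_sum i N y| - 1).
    by rewrite -[dual_sum i N y ^+ 2]real_normK ?num_real//; nra.
rewrite RintegralD; [|exact: measurable_circle| |]; last 2 first.
- by apply: continuous_integrable_circle; exact: cst_continuous.
- by apply: continuous_integrable_circle; apply: continuous_cstM.
rewrite RintegralZl; [|exact: measurable_circle|exact: continuous_integrable_circle].
rewrite Rintegral_circle_cst.
by have := integral_dual_sum_sqr i N; lra.
Qed.

(** The L_1 norm of the dual kernel is bounded independently of n, although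
    the values of the Noerlund one are of order l_n near the corner. *)
Lemma integral_norm_dual_kernel b (n : nat) :
  \int[mu]_(y in J) `|dual_kernel b n y| <= 9 * pi ^+ 2.
Proof.
have p0 := pi_gt0 R.
case: b; last first.
  under eq_Rintegral do rewrite dual_kernelF.
  by rewrite Rintegral_circle_cst ger0_norm; nra.
have cn i N : continuous (fun y => `|dual_sum i N y : R|).
  by apply: continuous_normr; exact: continuous_dual_sum.
have l0 := log_weight_gt0 n : 0 < log_weight n :> R.
apply: (@le_trans _ _ (\int[mu]_(y in J) ((log_weight n)^-1 *
  \sum_(i < n.+1) (i.+1%:R^-1 * (pi * `|dual_sum i (n - i) y|))))).
  apply: le_Rintegral.
  - exact: measurable_circle.
  - apply: continuous_integrable_circle; apply: continuous_normr.
    exact: continuous_dual_kernel.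
  - apply: continuous_integrable_circle; apply: continuous_cstM.
    apply: continuous_sumr => i; do 2 apply: continuous_cstM; exact: cn.
  - move=> y _; rewrite dual_kernelT normrM ger0_norm ?invr_ge0 ?(ltW l0)//.
    apply: ler_wpM2l; first by rewrite invr_ge0 ltW.
    apply: le_trans (ler_norm_sum _ _ _) _; apply: ler_sum => i _.
    rewrite !normrM [`|pi|]ger0_norm ?(ltW p0)//.
    by rewrite [`|_^-1|]ger0_norm ?invr_ge0.
have ci (i : 'I_n.+1) : continuous
    (fun y => i.+1%:R^-1 * (pi * `|dual_sum i (n - i) y|) : R).
  by do 2 apply: continuous_cstM; exact: cn.
rewrite RintegralZl; [|exact: measurable_circle|]; last first.
  by apply: continuous_integrable_circle; exact: continuous_sumr.
rewrite Rintegral_sum; [|exact: measurable_circle|]; last first.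
  by move=> i; exact: continuous_integrable_circle.
rewrite -[leRHS](log_weight_mean n); apply: ler_wpM2l.
  by rewrite invr_ge0 ltW.
apply: ler_sum => i _.
rewrite RintegralZl; [|exact: measurable_circle|]; last first.
  by apply: continuous_integrable_circle; apply: continuous_cstM; exact: cn.
apply: ler_wpM2l; first by rewrite invr_ge0.
rewrite RintegralZl; [|exact: measurable_circle|]; last first.
  by apply: continuous_integrable_circle; exact: cn.
rewrite expr2 mulrCA; apply: ler_wpM2l; first exact: ltW.
exact: integral_norm_dual_sum.
Qed.

Lemma norm_dual_kernel_le b (n : nat) (y : R) :
  `|dual_kernel b n y| <= pi * n.*2.+1%:R * (2 * pi).
Proof.
have ch : continuous (fun t : R => test_fun b n t * log_kernel b n (t - y)).
  move=> t; apply: continuousM; first exact: continuous_test_fun.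
  exact: continuous_log_kernel.
apply: le_trans (le_normr_Rintegral measurable_circle _) _.
  exact: continuous_integrable_circle.
rewrite -Rintegral_circle_cst; apply: le_Rintegral.
- exact: measurable_circle.
- by apply: continuous_integrable_circle; exact: continuous_normr.
- by apply: continuous_integrable_circle; exact: cst_continuous.
- move=> t Jt; rewrite normrM; apply: ler_pM => //.
    exact: norm_test_fun.
  exact: norm_log_kernel_le.
Qed.

End dual_bounds.

(** * Distributivity over dependent families *)

(** Distributivity of a product over sums whose index types depend on the
    factor. *)
Lemma prod_sum_dffun (R : comPzSemiRingType) (I : finType) (T : I -> finType)
    (F : forall i, T i -> R) :
  \prod_i \sum_(j : T i) F i j =
  \sum_(t : {dffun forall i, T i}) \prod_i F i (t i).
Proof.
rewrite (reindex (@dffun_of_fprod I T)); last exact/onW_bij/dffun_of_fprod_bij.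
under [RHS]eq_bigr do under eq_bigr do rewrite ffunE.
pose P i : {ffun T i -> R} := [ffun j => F i j].
transitivity (\sum_(t : fprod T) \prod_(i in I) P i (t i)); last first.
  by apply: eq_bigr => t _; apply: eq_bigr => i _; rewrite ffunE.
rewrite big_fprod.
rewrite -(bigA_distr_big_dep (tagged_with T) (fun i => untag 0 (P i))).
apply: eq_bigr => i _.
apply: etrans (big_tag (fun k (j : T k) => P k j) i).
by apply: eq_bigr => j _; rewrite ffunE.
Qed.

(** * Lebesgue measure on the torus *)

Section torus_measure.
Context {R : realType}.
Local Notation J := (@circle R).
Notation mu := (@lebesgue_measure R).

Lemma torusE d : torus = [set x : d.-tuple R | forall j, J (tnth x j)].
Proof. by []. Qed.

Lemma measurable_box d (A : 'I_d -> set (measurableTypeR R)) :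
  (forall j, measurable (A j)) ->
  measurable [set x : d.-tuple R | forall j, A j (tnth x j)].
Proof.
move=> mA; rewrite (_ : [set x | _] = \bigcap_(j in [set: 'I_d])
   ((fun x : d.-tuple R => tnth x j) @^-1` A j)); last first.
  by apply/seteqP; split=> x /= H j; [move=> _|]; exact: H.
apply: fin_bigcap_measurable => // j _.
rewrite -[X in measurable X]setTI.
by apply: measurable_tnth => //; exact: mA.
Qed.

Lemma measurable_torus d : measurable (@torus R d).
Proof. by apply: (@measurable_box _ (fun=> J)) => j; exact: measurable_circle. Qed.

Lemma lebesgue_torus d : @lebesgue_tuple R d torus = ((2 * pi) ^+ d)%:E.
Proof.
rewrite torusE (lebesgue_tuple_box (A := fun=> J)); last first.
  by move=> j; exact: measurable_circle.
rewrite (eq_bigr (fun=> (2 * pi)%:E)); last by move=> j _; exact: lebesgue_circle.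
by rewrite prodEFin prodr_const card_ord.
Qed.

Lemma lebesgue_torus_fin d : (@lebesgue_tuple R d torus < +oo)%E.
Proof. by rewrite lebesgue_torus ltry. Qed.

End torus_measure.

(** * The theorem of Fubini on measurable rectangles *)

Section fubini_on.
Context d1 d2 (T1 : measurableType d1) (T2 : measurableType d2) (R : realType).
Variables (m1 : {sigma_finite_measure set T1 -> \bar R}).
Variables (m2 : {sigma_finite_measure set T2 -> \bar R}).
Variables (D1 : set T1) (D2 : set T2).
Hypotheses (mD1 : measurable D1) (mD2 : measurable D2).

Lemma Rintegral_prod (F : T1 * T2 -> R) :
  (m1 \x m2)%E.-integrable (D1 `*` D2) (EFin \o F) ->
  (forall x, D1 x -> m2.-integrable D2 (fun y => (F (x, y))%:E)) ->
  \int[(m1 \x m2)%E]_(z in D1 `*` D2) F z =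
  \int[m1]_(x in D1) \int[m2]_(y in D2) F (x, y).
Proof.
move=> iF iF2; have mD : measurable (D1 `*` D2) by exact: measurableX.
rewrite /Rintegral integral_mkcond -integral12_prod_meas1; last first.
  exact: ((integrable_mkcond _ mD).1 iF).
rewrite [X in _ = fine X]integral_mkcond; congr fine.
apply: eq_integral => x _; rewrite /fubini_F patchE; case: ifPn => xD.
  rewrite fineK; last by apply: integrable_fin_num => //; apply: iF2; rewrite -inE.
  rewrite [RHS]integral_mkcond; apply: eq_integral => y _.
  by rewrite !patchE in_setX xD.
by apply: integral0_eq => y _; rewrite patchE in_setX (negbTE xD).
Qed.

Lemma Rintegral_swap (F : T1 * T2 -> R) :
  (m1 \x m2)%E.-integrable (D1 `*` D2) (EFin \o F) ->
  (forall x, D1 x -> m2.-integrable D2 (fun y => (F (x, y))%:E)) ->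
  (forall y, D2 y -> m1.-integrable D1 (fun x => (F (x, y))%:E)) ->
  \int[m1]_(x in D1) \int[m2]_(y in D2) F (x, y) =
  \int[m2]_(y in D2) \int[m1]_(x in D1) F (x, y).
Proof.
move=> iF iF2 iF1; have mD : measurable (D1 `*` D2) by exact: measurableX.
rewrite -Rintegral_prod//.
rewrite /Rintegral integral_mkcond -integral21_prod_meas1; last first.
  exact: ((integrable_mkcond _ mD).1 iF).
rewrite [X in _ = fine X]integral_mkcond; congr fine.
apply: eq_integral => y _; rewrite /fubini_G patchE; case: ifPn => yD.
  rewrite fineK; last by apply: integrable_fin_num => //; apply: iF1; rewrite -inE.
  rewrite [RHS]integral_mkcond; apply: eq_integral => x _.
  by rewrite !patchE in_setX yD andbT.
by apply: integral0_eq => x _; rewrite patchE in_setX (negbTE yD) andbF.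
Qed.

(** Exchange of the integrals of an integrable function against a bounded
    kernel. *)
Lemma Rintegral_kernel_swap (f : T2 -> R) (G : T1 * T2 -> R) (M : R) :
  (m1 D1 < +oo)%E -> m2.-integrable D2 (EFin \o f) ->
  measurable_fun setT G ->
  (forall x y, D1 x -> D2 y -> `|G (x, y)| <= M) ->
  \int[m1]_(x in D1) \int[m2]_(y in D2) (f y * G (x, y)) =
  \int[m2]_(y in D2) (f y * \int[m1]_(x in D1) G (x, y)).
Proof.
move=> fD1 fi mG GM.
have mD : measurable (D1 `*` D2) by exact: measurableX.
have mf : measurable_fun D2 f by apply/measurable_EFinP; exact: measurable_int fi.
have mF : measurable_fun (D1 `*` D2) (fun z : T1 * T2 => f z.2 * G z).
  apply: measurable_funM; last exact: measurable_funTS.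
  apply: (measurable_comp mD2 _ mf) => //; first by move=> _ [z [_ ?] <-].
  exact: measurable_funTS.
have iF2 x : D1 x -> m2.-integrable D2 (fun y => (f y * G (x, y))%:E).
  move=> xD; apply: (integrable_mul_bounded (M := M) mD2 fi) => [|y].
    by apply: measurable_funTS; apply: measurableT_comp.
  exact: GM.
have iF1 y : D2 y -> m1.-integrable D1 (fun x => (f y * G (x, y))%:E).
  move=> yD; apply: (@bounded_integrable _ _ _ _ _ _ (`|f y| * M)) => //.
    apply: measurable_funM => //.
    by apply: measurable_funTS; apply: measurableT_comp.
  by move=> x xD; rewrite normrM; apply: ler_wpM2l => //; exact: GM.
rewrite (@Rintegral_swap (fun z => f z.2 * G z))//.
  apply: eq_Rintegral => y /set_mem yD /=; rewrite RintegralZl//.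
  apply: (@bounded_integrable _ _ _ _ _ _ M) => //.
    by apply: measurable_funTS; apply: measurableT_comp.
  by move=> x xD; exact: GM.
pose H := (EFin \o (fun z : T1 * T2 => f z.2 * G z)) \_ (D1 `*` D2).
have mH : measurable_fun setT H.
  by apply: (measurable_restrictT _ mD).1; apply/measurable_EFinP.
(* It remains to see that F is integrable on the rectangle; the inner integrals
   of its absolute value are bounded by K. *)
apply: (integrable_mkcond _ mD).2; apply: (integrable12ltyP _ _ mH).2.
pose K := (\int[m2]_(y in D2) `|(M * f y)%:E|)%E.
have Kfin : (K < +oo)%E by have /integrableP[] := integrableZl mD2 M fi.
have K0 : (0 <= K)%E by exact: integral_ge0.
apply: (@le_lt_trans _ _ (\int[m1]_(x in D1) K)%E); last first.
  rewrite integral_cst//; apply: lte_mul_pinfty => //.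
  by rewrite ge0_fin_numE.
rewrite [leRHS]integral_mkcond; apply: ge0_le_integral => //.
- by move=> x _; exact: integral_ge0.
- apply: (measurable_fun_fubini_tonelli_F (abse \o H)) => //=.
  exact: measurableT_comp.
- by apply: (measurable_restrictT _ mD1).1; exact: measurable_cst.
- move=> x _; rewrite patchE; case: ifPn => [/set_mem xD|xD].
    rewrite /K [leRHS]integral_mkcond; apply: ge0_le_integral => //.
    + by do 2 apply: measurableT_comp => //; exact: pair1_measurable.
    + apply: (measurable_restrictT _ mD2).1; apply: measurableT_comp => //.
      by apply/measurable_EFinP; exact: measurable_funM.
    + move=> y _; rewrite /H !patchE in_setX mem_set//=.
      case: ifPn => [/set_mem yD|]; last by rewrite abse0.
      rewrite lee_fin !normrM mulrC; apply: ler_wpM2r => //.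
      by apply: le_trans (ler_norm M); exact: GM.
  by rewrite integral0_eq// => y _; rewrite /H patchE in_setX (negbTE xD) abse0.
Qed.

End fubini_on.

(** * Integrals of product functions over the torus *)

Section torus_fubini.
Context {R : realType}.
Local Notation J := (@circle R).
Notation mu := (@lebesgue_measure R).
Local Notation mut d := (@lebesgue_tuple R d).

Lemma integral_torus_recl d (F : d.+1.-tuple R -> R) (M : R) :
  measurable_fun setT F -> (forall x, torus x -> `|F x| <= M) ->
  \int[mut d.+1]_(x in torus) F x =
  \int[mu]_(u in J) \int[mut d]_(t in torus) F (tuple_cons (u, t)).
Proof.
move=> mF FM.
have mT := @measurable_torus R.
have JT (u : R) (t : d.-tuple R) : J u -> torus t -> torus (tuple_cons (u, t)).
  move=> Ju Tt j; case: (unliftP ord0 j) => [k|] ->; last exact: Ju.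
  by rewrite tnthS; exact: Tt.
pose P := (mu \x mut d)%E :
  {measure set (measurableTypeR R * d.-tuple R)%type -> \bar R}.
have preT : @tuple_cons R d @^-1` torus = J `*` torus.
  apply/seteqP; split=> -[u t] /=.
    move=> H; split=> [|j]; first exact: (H ord0).
    by have := H (lift ord0 j); rewrite tnthS.
  by case; exact: JT.
have mFc : measurable_fun setT (F \o @tuple_cons R d).
  exact: measurableT_comp mF (@measurable_tuple_cons R d).
have iF : P.-integrable (J `*` torus) (EFin \o (F \o @tuple_cons R d)).
  apply: (@bounded_integrable _ _ _ _ _ _ M).
  - by apply: measurableX; [exact: measurable_circle|exact: mT].
  - rewrite /P /= product_measure1E; [|exact: measurable_circle|exact: mT].
    by rewrite lte_mul_pinfty// ?ge0_fin_numE//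
      ?lebesgue_circle_fin ?lebesgue_torus_fin.
  - exact: measurable_funTS.
  - by move=> [u t] [Ju Tt]; apply: FM; exact: JT.
transitivity (\int[P]_(z in J `*` torus) (F (tuple_cons z))).
  rewrite /Rintegral -preT; congr fine.
  rewrite -(@integral_pushforward _ _ _ _ _ _
    (@measurable_tuple_cons R d) P _ (EFin \o F))//.
  - exact/measurable_EFinP.
  - by rewrite preT.
  - exact: mT.
apply: (Rintegral_prod measurable_circle (mT d) iF) => u Ju.
apply: (@bounded_integrable _ _ _ _ _ _ M).
- exact: mT.
- exact: lebesgue_torus_fin.
- apply: measurable_funTS; apply: (measurableT_comp mFc).
  exact: pair1_measurable.
- by move=> t Tt; apply: FM; exact: JT.
Qed.

Lemma measurable_prod_tnth d (g : 'I_d -> R -> R) :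
  (forall j, measurable_fun setT (g j)) ->
  measurable_fun setT (fun x : d.-tuple R => \prod_j g j (tnth x j)).
Proof.
move=> mg; apply: measurable_prod => j _.
by apply: (measurableT_comp (mg j)); exact: measurable_tnth.
Qed.

Lemma norm_prod_tnth_le d (g : 'I_d -> R -> R) (M : R) (x : d.-tuple R) :
  (forall j t, J t -> `|g j t| <= M) -> torus x ->
  `|\prod_j g j (tnth x j)| <= M ^+ d.
Proof.
move=> gM Tx; rewrite normr_prod -[d in leRHS]card_ord -prodr_const.
by apply: ler_prod => j _; rewrite normr_ge0 gM//; exact: Tx.
Qed.

Lemma integral_torus_prod d (g : 'I_d -> R -> R) (M : R) :
  (forall j, measurable_fun setT (g j)) ->
  (forall j t, J t -> `|g j t| <= M) ->
  \int[mut d]_(x in torus) \prod_j g j (tnth x j) =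
  \prod_j \int[mu]_(t in J) g j t.
Proof.
elim: d g => [|d IH] g mg gM.
  under eq_Rintegral do rewrite big_ord0.
  rewrite Rintegral_cst; last exact: measurable_torus.
  rewrite big_ord0 mul1r.
  by rewrite -[LHS]/(fine (mut 0 torus)) lebesgue_torus.
rewrite (@integral_torus_recl _ _ (M ^+ d.+1)); last 2 first.
- exact: measurable_prod_tnth.
- by move=> x; exact: norm_prod_tnth_le.
rewrite big_ord_recl.
rewrite -(IH (fun j => g (lift ord0 j)) (fun j => mg _) (fun j => gM _)).
set I := \int[_]_(x in torus) _.
rewrite -RintegralZr; [|exact: measurable_circle|]; last first.
  apply: (@bounded_integrable _ _ _ _ _ _ M).
  - exact: measurable_circle.
  - exact: lebesgue_circle_fin.
  - by apply: measurable_funTS; exact: mg.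
  - by move=> t; exact: gM.
apply: eq_Rintegral => u /set_mem Ju.
rewrite -RintegralZl; [|exact: measurable_torus|]; last first.
  apply: (@bounded_integrable _ _ _ _ _ _ (M ^+ d)).
  - exact: measurable_torus.
  - exact: lebesgue_torus_fin.
  - apply: measurable_funTS; move=> /=.
    apply: (@measurable_prod_tnth _ (fun j => g (lift ord0 j))) => j.
    exact: mg.
  - move=> x; apply: (@norm_prod_tnth_le _ (fun j => g (lift ord0 j))) => j.
    exact: gM.
apply: eq_Rintegral => t _; rewrite big_ord_recl; congr (_ * _).
by apply: eq_bigr => j _; rewrite tnthS.
Qed.

End torus_fubini.

(** * Complex exponentials and moduli *)

Section complex_tools.
Context {R : realType}.
Implicit Types z w : R[i].

Lemma Re_realM (r : R) z : complex.Re (r%:C * z) = r * complex.Re z.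
Proof. by case: z => a b /=; rewrite mul0r subr0. Qed.

Lemma Re_sum (I : Type) (s : seq I) (P : pred I) (F : I -> R[i]) :
  complex.Re (\sum_(i <- s | P i) F i) = \sum_(i <- s | P i) complex.Re (F i).
Proof. by apply: (big_morph (@complex.Re R)) => // -[a b] [c e]. Qed.

Lemma Im_sum (I : Type) (s : seq I) (P : pred I) (F : I -> R[i]) :
  complex.Im (\sum_(i <- s | P i) F i) = \sum_(i <- s | P i) complex.Im (F i).
Proof. by apply: (big_morph (@complex.Im R)) => // -[a b] [c e]. Qed.

Lemma cisD (a b : R) : cis (a + b) = cis a * cis b.
Proof. by rewrite /cis sinD cosD; congr (_ +i* _); rewrite addrC. Qed.

Lemma cis_sum (I : Type) (s : seq I) (a : I -> R) :
  cis (\sum_(i <- s) a i) = \prod_(i <- s) cis (a i).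
Proof. by apply: (big_morph _ cisD); rewrite /cis cos0 sin0. Qed.

(** The imaginary parts of opposite frequencies cancel. *)
Lemma sum_cis (N : nat) (t : R) :
  \sum_(k < N.*2.+1) cis ((k%:Z - N%:Z)%:~R * t) = (dirichlet N t)%:C.
Proof.
apply/eqP; rewrite eq_complex Re_sum Im_sum /= eqxx /=.
set S := \sum_(k < _) _; suff : S = - S by move=> H; apply/eqP; lra.
rewrite {1}/S (reindex_inj rev_ord_inj) /= -sumrN; apply: eq_bigr => k _.
rewrite -sinN -mulNr -mulrNz; congr (sin (_%:~R * _)).
by have := ltn_ord k; lia.
Qed.

Lemma sum_cos_dffun (d : nat) (N : 'I_d -> nat) (z : 'I_d -> R) :
  \sum_(k : {dffun forall j : 'I_d, 'I_(N j).*2.+1})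
     cos (\sum_j ((k j)%:Z - (N j)%:Z)%:~R * z j) =
  \prod_j dirichlet (N j) (z j).
Proof.
transitivity (complex.Re (\prod_j (dirichlet (N j) (z j))%:C)); last first.
  by rewrite -(rmorph_prod (@real_complex R)).
under eq_bigr do rewrite -sum_cis.
rewrite prod_sum_dffun Re_sum; apply: eq_bigr => k _.
by rewrite -cis_sum.
Qed.

Lemma Re_le_normc z : `|complex.Re z| <= ComplexField.Normc.normc z.
Proof.
case: z => a b /=; rewrite -sqrtr_sqr ler_wsqrtr//.
by rewrite lerDl sqr_ge0.
Qed.

Lemma complex_normcE z : ComplexField.Normc.normc z =
  Num.sqrt (complex.Re z ^+ 2 + complex.Im z ^+ 2).
Proof. by case: z. Qed.

Lemma complex_normc_ge0 z : 0 <= ComplexField.Normc.normc z.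
Proof. by rewrite complex_normcE sqrtr_ge0. Qed.

Lemma measurable_normc d (T : measurableType d) (D : set T) (f : T -> R[i]) :
  measurable_fun D (fun x => complex.Re (f x)) ->
  measurable_fun D (fun x => complex.Im (f x)) ->
  measurable_fun D (fun x => ComplexField.Normc.normc (f x)).
Proof.
move=> mr mi; under eq_fun do rewrite complex_normcE.
have ms : measurable_fun setT (@Num.sqrt R).
  by apply: continuous_measurable_fun; exact: sqrt_continuous.
by apply: (measurableT_comp ms); apply: measurable_funD; apply: measurable_funX.
Qed.

Lemma le_fine_abse (z : \bar R) : (`|fine z|%:E <= `|z|)%E.
Proof. by case: z => [r| |] //=; rewrite normr0 leey. Qed.

End complex_tools.

(** * The means as integral operators, and their lower bound by duality *)

Section representation.
Context {R : realType} {d : nat}.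
Variables (B : {set 'I_d}) (n : nat).
Notation mu := (@lebesgue_measure R).
Local Notation mut := (@lebesgue_tuple R d).
Local Notation J := (@circle R).

(** The kernel of the mixed means in d variables. *)
Definition mixed_kernel (x y : d.-tuple R) : R :=
  \prod_j log_kernel (j \in B) n (tnth x j - tnth y j).

(** The product of the test functions of all the variables. *)
Definition mixed_test (x : d.-tuple R) : R :=
  \prod_j test_fun (j \in B) n (tnth x j).

(** The product of the dual kernels of all the variables. *)
Definition mixed_dual (y : d.-tuple R) : R :=
  \prod_j dual_kernel (j \in B) n (tnth y j).

(** Expansion of the kernel into the cosines that come from the definition of
    the means. *)
Lemma mixed_kernelE (x y : d.-tuple R) :
  (\prod_(j < d) log_weight n)^-1 *
  \sum_(i : {dffun forall j : 'I_d, 'I_n.+1})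
    ((\prod_(j < d) (i j).+1%:R)^-1 *
     \sum_(k : {dffun forall j : 'I_d,
                 'I_((if j \in B then n - i j else i j)%N).*2.+1})
      cos (\sum_j ((k j)%:Z - ((if j \in B then n - i j else i j)%N)%:Z)%:~R
                  * (tnth x j - tnth y j))) =
  mixed_kernel x y.
Proof.
under [X in _ * X]eq_bigr => i _ do
  rewrite (sum_cos_dffun (fun j => if j \in B then n - i j else i j)%N)
    -prodfV -big_split /=.
rewrite -(prod_sum_dffun (fun (j : 'I_d) (i : 'I_n.+1) => i.+1%:R^-1 *
  dirichlet (if j \in B then n - i else i)%N (tnth x j - tnth y j))).
by rewrite -prodfV -big_split.
Qed.

Lemma measurable_dotp (k : 'I_d -> int) :
  measurable_fun setT (fun x : d.-tuple R => dotp k x).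
Proof.
apply: measurable_sum => j; apply: measurable_funM => //.
exact: measurable_tnth.
Qed.

Lemma Re_fourier_term (g : d.-tuple R -> R) (k : 'I_d -> int) (x : d.-tuple R) :
  mut.-integrable torus (EFin \o g) ->
  complex.Re (fourier_coef (fun y => (g y)%:C) k * cis (dotp k x)) =
  (2 * pi) ^- d * \int[mut]_(y in torus)
     (g y * cos (\sum_j (k j)%:~R * (tnth x j - tnth y j))).
Proof.
move=> gi; have mT := @measurable_torus R d.
have cgi (f : R -> R) : measurable_fun setT f -> (forall t, `|f t| <= 1) ->
    mut.-integrable torus (EFin \o (fun y => g y * f (- dotp k y))).
  move=> mf f1; apply: integrable_mul_bounded gi _ (fun x _ => f1 _) => //.
  apply: measurable_funTS; apply: measurableT_comp => //.
  by apply: measurableT_comp => //; exact: measurable_dotp.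
have mc : measurable_fun setT (@cos R).
  by apply: continuous_measurable_fun; exact: continuous_cos.
have ms : measurable_fun setT (@sin R).
  by apply: continuous_measurable_fun; exact: continuous_sin.
rewrite /fourier_coef -mulrA Re_realM; congr (_ * _).
rewrite /cintegral /cis /=.
under [X in X * _ - _]eq_Rintegral do rewrite mul0r subr0.
under [X in _ - X * _]eq_Rintegral do rewrite mul0r addr0.
rewrite -RintegralZr; [|exact: mT|exact: (cgi _ mc (@cos_max R))].
rewrite -RintegralZr; [|exact: mT|exact: (cgi _ ms (@sin_max R))].
rewrite -RintegralB; [|exact: mT| |]; last 2 first.
- exact: (integrableZr mT _ (cgi _ mc (@cos_max R))).
- exact: (integrableZr mT _ (cgi _ ms (@sin_max R))).
apply: eq_Rintegral => y _.
have -> : \sum_j (k j)%:~R * (tnth x j - tnth y j) = - dotp k y + dotp k x.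
  rewrite /dotp addrC -sumrB; apply: eq_bigr => j _; by rewrite mulrBr.
by rewrite cosD; ring.
Qed.

(** For a real integrable function g, the real part of the means is the integral
    operator of kernel mixed_kernel. *)
Lemma Re_log_mean (g : d.-tuple R -> R) (x : d.-tuple R) :
  mut.-integrable torus (EFin \o g) ->
  complex.Re (diag_log_mean B n (fun y => (g y)%:C) x) =
  (2 * pi) ^- d * \int[mut]_(y in torus) (g y * mixed_kernel x y).
Proof.
move=> gi; have mT := @measurable_torus R d.
have mc : measurable_fun setT (@cos R).
  by apply: continuous_measurable_fun; exact: continuous_cos.
have ci (k : 'I_d -> int) : mut.-integrable torus (EFin \o (fun y : d.-tuple R =>
    (g y * cos (\sum_j (k j)%:~R * (tnth x j - tnth y j))))).
  apply: integrable_mul_bounded gi _ (fun x _ => cos_max _) => //.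
  apply: measurable_funTS; apply: measurableT_comp => //.
  apply: measurable_sum => j.
  apply: measurable_funM => //; apply: measurable_funB => //.
  exact: measurable_tnth.
rewrite /diag_log_mean /mixed_log_mean Re_realM Re_sum.
under [X in _ * X]eq_bigr => i _ do (rewrite Re_realM /partial_sum Re_sum;
  under [X in _ * X]eq_bigr => k _ do rewrite (Re_fourier_term _ _ gi)).
under [X in _ * X]eq_bigr => i _ do (rewrite -mulr_sumr -Rintegral_sum//;
  rewrite mulrCA).
rewrite -mulr_sumr mulrCA; congr (_ * _).
pose N (i : {dffun forall j : 'I_d, 'I_n.+1}) j : nat :=
  (if j \in B then n - i j else i j)%N.
pose S (i : {dffun forall j : 'I_d, 'I_n.+1}) (y : d.-tuple R) :=
  \sum_(k : {dffun forall j : 'I_d, 'I_(N i j).*2.+1})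
    g y * cos (\sum_j ((k j)%:Z - (N i j)%:Z)%:~R * (tnth x j - tnth y j)).
have iS i : mut.-integrable torus (EFin \o S i).
  by apply: integrable_sumr => // k; exact: ci.
transitivity (\int[mut]_(y in torus) ((\prod_(j < d) log_weight n)^-1 *
  \sum_(i : {dffun forall j : 'I_d, 'I_n.+1})
    ((\prod_(j < d) (i j).+1%:R)^-1 * S i y))); last first.
  apply: eq_Rintegral => y _; rewrite -mixed_kernelE mulrCA; congr (_ * _).
  rewrite mulr_sumr; apply: eq_bigr => i _; rewrite mulrCA; congr (_ * _).
  by rewrite mulr_sumr.
have iSa (i : {dffun forall j : 'I_d, 'I_n.+1}) : mut.-integrable torus
    (EFin \o (fun y => (\prod_(j < d) (i j).+1%:R)^-1 * S i y)).
  exact: (integrableZl mT _ (iS i)).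
rewrite RintegralZl//; last by apply: integrable_sumr => // i; exact: iSa.
congr (_ * _); rewrite Rintegral_sum//; apply: eq_bigr => i _.
by rewrite RintegralZl//; exact: iS.
Qed.

Lemma measurable_mixed_test : measurable_fun setT mixed_test.
Proof.
apply: (@measurable_prod_tnth R d (fun j => test_fun (j \in B) n)) => j.
by apply: continuous_measurable_fun; exact: continuous_test_fun.
Qed.

Lemma norm_mixed_test (x : d.-tuple R) : torus x -> `|mixed_test x| <= pi ^+ d.
Proof.
apply: (@norm_prod_tnth_le R d (fun j => test_fun (j \in B) n)) => j t.
exact: norm_test_fun.
Qed.

Lemma measurable_mixed_kernel :
  measurable_fun setT (fun z : d.-tuple R * d.-tuple R => mixed_kernel z.1 z.2).
Proof.
apply: measurable_prod => j _.
have mk : measurable_fun setT (log_kernel (j \in B) n : R -> R).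
  apply: continuous_measurable_fun; have := @continuous_log_kernel R (j \in B) n 0.
  by under eq_fun do rewrite subr0.
apply: (measurableT_comp mk); apply: measurable_funB.
  by apply: (measurableT_comp (@measurable_tnth _ _ _ j)); exact: measurable_fst.
by apply: (measurableT_comp (@measurable_tnth _ _ _ j)); exact: measurable_snd.
Qed.

Lemma norm_mixed_kernel (x y : d.-tuple R) :
  `|mixed_kernel x y| <= n.*2.+1%:R ^+ d.
Proof.
rewrite normr_prod -[d in leRHS]card_ord -prodr_const.
by apply: ler_prod => j _; rewrite normr_ge0 norm_log_kernel_le.
Qed.

Lemma measurable_mixed_dual : measurable_fun setT mixed_dual.
Proof.
apply: (@measurable_prod_tnth R d (fun j => dual_kernel (j \in B) n)) => j.
by apply: continuous_measurable_fun; exact: continuous_dual_kernel.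
Qed.

Lemma integrable_mul_dual (g : d.-tuple R -> R) :
  mut.-integrable torus (EFin \o g) ->
  mut.-integrable torus (EFin \o (fun y => g y * mixed_dual y)).
Proof.
move=> gi; have mT := @measurable_torus R d.
apply: (@integrable_mul_bounded _ _ _ _ _ _ _
    ((pi * n.*2.+1%:R * (2 * pi)) ^+ d)) => //.
  by apply: measurable_funTS; exact: measurable_mixed_dual.
move=> x; apply: (@norm_prod_tnth_le R d (fun j => dual_kernel (j \in B) n)).
by move=> j t _; exact: norm_dual_kernel_le.
Qed.

Lemma integral_test_mean (g : d.-tuple R -> R) :
  mut.-integrable torus (EFin \o g) ->
  \int[mut]_(x in torus)
    (mixed_test x * complex.Re (diag_log_mean B n (fun y => (g y)%:C) x)) =
  (2 * pi) ^- d * \int[mut]_(y in torus) (g y * mixed_dual y).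
Proof.
move=> gi; have mT := @measurable_torus R d.
pose G (z : d.-tuple R * d.-tuple R) := (2 * pi) ^- d *
   (mixed_test z.1 * mixed_kernel z.1 z.2).
have p0 := pi_gt0 R.
have pd0 : 0 <= (2 * pi : R) ^- d by rewrite invr_ge0 exprn_ge0// mulr_ge0// ltW.
have ig (x : d.-tuple R) :
    mut.-integrable torus (EFin \o (fun y => g y * mixed_kernel x y)).
  apply: integrable_mul_bounded gi _ (fun y _ => norm_mixed_kernel x y) => //.
  apply: measurable_funTS.
  exact: (measurableT_comp measurable_mixed_kernel (pair1_measurable x)).
transitivity (\int[mut]_(x in torus) \int[mut]_(y in torus) (g y * G (x, y))).
  apply: eq_Rintegral => x _; rewrite Re_log_mean// mulrA -RintegralZl//.
  by apply: eq_Rintegral => y _; rewrite /G /=; ring.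
rewrite (@Rintegral_kernel_swap _ _ _ _ _ _ _ _ _ mT mT g G
    ((2 * pi) ^- d * (pi ^+ d * n.*2.+1%:R ^+ d)))//; last 3 first.
- exact: lebesgue_torus_fin.
- apply: measurable_funM => //; apply: measurable_funM.
    exact: (measurableT_comp measurable_mixed_test measurable_fst).
  exact: measurable_mixed_kernel.
- move=> x y Tx Ty; rewrite /G /= !normrM (ger0_norm pd0).
  apply: ler_wpM2l => //; apply: ler_pM => //.
    exact: norm_mixed_test.
  exact: norm_mixed_kernel.
rewrite -RintegralZl//; last exact: integrable_mul_dual.
apply: eq_Rintegral => y /set_mem Ty; rewrite mulrCA; congr (_ * _).
pose h j (t : R) := test_fun (j \in B) n t * log_kernel (j \in B) n (t - tnth y j).
have mh j : measurable_fun setT (h j).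
  apply: continuous_measurable_fun => t; apply: continuousM.
    exact: continuous_test_fun.
  exact: continuous_log_kernel.
have hM j t : J t -> `|h j t| <= pi * n.*2.+1%:R.
  move=> Jt; rewrite normrM; apply: ler_pM => //.
    exact: norm_test_fun.
  exact: norm_log_kernel_le.
have E x : mixed_test x * mixed_kernel x y = \prod_j h j (tnth x j).
  by rewrite -big_split.
rewrite /G /= RintegralZl//; last first.
  under eq_fun do rewrite E.
  apply: (@bounded_integrable _ _ _ _ _ _ ((pi * n.*2.+1%:R) ^+ d)) => //.
  - exact: lebesgue_torus_fin.
  - by apply: measurable_funTS; exact: measurable_prod_tnth.
  - by move=> x; exact: norm_prod_tnth_le.
congr (_ * _); under eq_Rintegral do rewrite E.
by rewrite (integral_torus_prod mh hM).
Qed.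

Lemma measurable_log_mean (f : d.-tuple R -> R[i]) :
  measurable_fun setT (fun x => complex.Re (diag_log_mean B n f x)) /\
  measurable_fun setT (fun x => complex.Im (diag_log_mean B n f x)).
Proof.
pose cm (h : d.-tuple R -> R[i]) :=
  measurable_fun setT (fun x => complex.Re (h x)) /\
  measurable_fun setT (fun x => complex.Im (h x)).
have cmZ z h : cm h -> cm (fun x => z * h x).
  case: z => a b [mr mi]; split.
    rewrite (_ : (fun _ => _) =
        fun x => a * complex.Re (h x) - b * complex.Im (h x)).
      by apply: measurable_funB; apply: measurable_funM.
    by apply/funext => x; case: (h x).
  rewrite (_ : (fun _ => _) = fun x => a * complex.Im (h x) + b * complex.Re (h x)).
    by apply: measurable_funD; apply: measurable_funM.
  by apply/funext => x; case: (h x).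
have cmS (I : Type) (s : seq I) (h : I -> d.-tuple R -> R[i]) :
    (forall i, cm (h i)) -> cm (fun x => \sum_(i <- s) h i x).
  move=> mh; split.
    under eq_fun do rewrite Re_sum.
    by apply: measurable_sum => i; exact: (mh i).1.
  under eq_fun do rewrite Im_sum.
  by apply: measurable_sum => i; exact: (mh i).2.
have cmC k : cm (fun x => cis (dotp k x)).
  split; apply: measurableT_comp (@measurable_dotp k).
    by apply: continuous_measurable_fun; exact: continuous_cos.
  by apply: continuous_measurable_fun; exact: continuous_sin.
suff : cm (diag_log_mean B n f) by [].
by do 2 (apply: (cmZ); apply: (cmS) => ?); apply: (cmZ).
Qed.

(** The lower bound by duality. The test function is bounded by pi^d on the
    torus. *)
Lemma norm_L1_log_mean_ge (g : d.-tuple R -> R) :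
  mut.-integrable torus (EFin \o g) ->
  (((2 * pi) ^- d * `|\int[mut]_(y in torus) (g y * mixed_dual y)|)%R%:E <=
   (pi ^+ d)%R%:E * norm_L1 (diag_log_mean B n (fun y => (g y)%:C)%R))%E.
Proof.
move=> gi; have mT := @measurable_torus R d; have p0 := pi_gt0 R.
have pd0 : 0 <= (2 * pi : R) ^- d by rewrite invr_ge0 exprn_ge0// mulr_ge0// ltW.
rewrite -[X in X * `|_|](ger0_norm pd0) -normrM -integral_test_mean//.
set T := diag_log_mean _ _ _.
have [mRe mIm] := measurable_log_mean (fun y => (g y)%:C).
have mN : measurable_fun setT (fun x => ComplexField.Normc.normc (T x)).
  exact: measurable_normc.
apply: (@le_trans _ _ (`|\int[mut]_(x in torus)
    (mixed_test x * complex.Re (T x))%:E|)%E).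
  exact: le_fine_abse.
apply: le_trans (le_abse_integral _ mT _) _.
  apply/measurable_EFinP; apply: measurable_funM.
    by apply: measurable_funTS; exact: measurable_mixed_test.
  exact: measurable_funTS.
rewrite /norm_L1 -ge0_integralZl_EFin//; last 3 first.
- by move=> x _; rewrite lee_fin complex_normcE sqrtr_ge0.
- by apply/measurable_EFinP; apply: measurable_funTS.
- by rewrite exprn_ge0// ltW.
apply: ge0_le_integral => //.
- by apply/measurableT_comp => //; apply/measurable_EFinP; apply: measurable_funM;
    apply: measurable_funTS => //; exact: measurable_mixed_test.
- by apply/measurable_EFinP; apply: measurable_funM => //; exact: measurable_funTS.
- move=> x Tx; rewrite lee_fin normrM; apply: ler_pM => //.
    exact: norm_mixed_test.
  exact: Re_le_normc.
Qed.

End representation.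

(** * Young functions and the growth gap *)

Section young.
Context {R : realType}.
Variables (Q : R -> R).
Hypothesis hQ : young_function Q.

(** By convexity Q(0) is at most the mean of Q(u) and Q(-u), which are equal. *)
Lemma young_ge0 (u : R) : 0 <= Q u.
Proof.
have h0 : 0 <= 2^-1 :> R by lra.
have h1 : 2^-1 <= 1 :> R by lra.
have := @young_convex _ _ hQ (Itv01 h0 h1) u (- u) (in_setT _) (in_setT _).
rewrite !convRE /= (young_even hQ) /unstable.onem => H.
suff E : conv (Itv01 h0 h1) (u : convex_lmodType R^o) (- u) = 0.
  by move: H; rewrite E (young0 hQ); lra.
apply: etrans (convRE (u : R^o) (- u) (Itv01 h0 h1)) _.
by rewrite /= /unstable.onem; lra.
Qed.

Lemma young_ge_id : exists V : R, forall v, V <= v -> v <= Q v.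
Proof.
have /cvgryPge /(_ 1) [V [_ VP]] := young_pinfty hQ.
exists (Num.max (V + 1) 1) => v; rewrite ge_max => /andP[v1 v2].
have v0 : 0 < v by lra.
have Vv : V < v by lra.
have := VP v Vv.
by rewrite ler_pdivlMr// mul1r.
Qed.

Lemma measurable_young : measurable_fun setT Q.
Proof. by apply: continuous_measurable_fun; exact: young_continuous hQ. Qed.

Lemma LlogL_young_ge0 r (u : R) : 0 <= LlogL_young r u.
Proof. by rewrite mulr_ge0// exprn_ge0// ln_ge0// lerDl. Qed.

Lemma LlogL_youngZ r (c u : R) : 0 <= c <= 1 ->
  LlogL_young r (c * u) <= c * LlogL_young r u.
Proof.
move=> /andP[c0 c1]; rewrite /LlogL_young normrM (ger0_norm c0) -mulrA.
apply: ler_wpM2l => //; apply: ler_wpM2l => //.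
have cu : c * `|u| <= `|u| by rewrite ler_piMl.
have p1 : 0 < 1 + c * `|u| by rewrite ltr_pwDl// mulr_ge0.
apply: lerXn2r; rewrite ?nnegrE.
- by rewrite ln_ge0// lerDl mulr_ge0.
- by rewrite ln_ge0// lerDl.
- by rewrite ler_ln ?posrE ?lerD2l// ltr_pwDl.
Qed.

Lemma le_LlogL_young r (u v : R) : 0 <= u -> u <= v ->
  LlogL_young r u <= LlogL_young r v.
Proof.
move=> u0 uv; have v0 := le_trans u0 uv.
rewrite /LlogL_young !ger0_norm//; apply: ler_pM => //.
  by rewrite exprn_ge0// ln_ge0// lerDl.
apply: lerXn2r; rewrite ?nnegrE ?ln_ge0 ?lerDl//.
by rewrite ler_ln ?posrE ?lerD2l//; lra.
Qed.

Lemma measurable_LlogL_young r : measurable_fun setT (@LlogL_young R r).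
Proof.
apply: measurable_funM; first exact: normr_measurable.
apply: measurable_funX; apply: measurableT_comp; first exact: measurable_ln.
by apply: measurable_funD => //; exact: normr_measurable.
Qed.

(** If u ln^r(1+u) <= C Q(u) for all u >= V, then u ln^r(1+u) <= C Q(u) + D for
    all u >= 0, where D is the value of u ln^r(1+u) at V; if k is
    admissible in the Luxemburg norm of f for Q, then M k is admissible for
    L log^r L, for some constant M. *)
Lemma orlicz_subset_LlogL d r (C V : R) : 0 <= C -> 0 <= V ->
  (forall v, V <= v -> LlogL_young r v <= C * Q v) ->
  @orlicz_space R d Q `<=` @LlogL R d r.
Proof.
move=> C0 V0 H f [[mr mi] fQ]; split; first by [].
have [_ /= [k [k0 kQ] <-] _] := ereal_inf_lt fQ.
have mT := @measurable_torus R d.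
pose D := LlogL_young r V.
have D0 : 0 <= D by exact: LlogL_young_ge0.
have HD u : 0 <= u -> LlogL_young r u <= C * Q u + D.
  move=> u0; case: (leP V u) => [/H h|/ltW uV].
    by apply: le_trans h _; rewrite lerDl.
  apply: le_trans (le_LlogL_young r u0 uV) _; rewrite lerDr.
  by rewrite mulr_ge0// young_ge0.
(* The admissible multiple: it dominates 1 and C + D |torus|. *)
pose M := 1 + C + D * (2 * pi) ^+ d.
have pd0 : 0 <= (2 * pi : R) ^+ d by rewrite exprn_ge0// mulr_ge0// pi_ge0.
have M1 : 1 <= M by have := mulr_ge0 D0 pd0; rewrite /M; lra.
have M0 : 0 < M by lra.
have mn : measurable_fun torus (fun x => ComplexField.Normc.normc (f x)).
  exact: measurable_normc.
apply: (@le_lt_trans _ _ (M * k)%:E); last exact: ltry.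
apply: ereal_inf_lbound; exists (M * k) => //; split; first exact: mulr_gt0.
have mQ : measurable_fun torus (fun x => Q (ComplexField.Normc.normc (f x) / k)).
  apply: measurableT_comp; first exact: measurable_young.
  exact: measurable_funM.
apply: (@le_trans _ _ (\int[@lebesgue_tuple R d]_(x in torus)
   ((M^-1)%:E * ((C * Q (ComplexField.Normc.normc (f x) / k))%:E + D%:E)))%E).
  apply: ge0_le_integral => //.
  - by move=> x _; rewrite lee_fin LlogL_young_ge0.
  - apply/measurable_EFinP; apply: measurableT_comp.
      exact: measurable_LlogL_young.
    exact: measurable_funM.
  - under eq_fun do rewrite -EFinD -EFinM.
    by apply/measurable_EFinP; apply: measurable_funM => //;
      apply: measurable_funD => //;
      apply: measurable_funM.
  - move=> x _; rewrite -EFinD -EFinM lee_fin.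
    set w := ComplexField.Normc.normc (f x).
    rewrite (_ : w / (M * k) = M^-1 * (w / k)); last by rewrite invfM; ring.
    apply: le_trans (LlogL_youngZ _ _ _) _.
      by rewrite invr_ge0 invf_le1// M1 andbT ltW.
    apply: ler_wpM2l; first by rewrite invr_ge0 ltW.
    by apply: HD; rewrite divr_ge0 ?complex_normc_ge0// ltW.
rewrite ge0_integralZl_EFin//; last 3 first.
- by move=> x _; rewrite -EFinD lee_fin addr_ge0// mulr_ge0// young_ge0.
- by under eq_fun do rewrite -EFinD; apply/measurable_EFinP;
    apply: measurable_funD => //; apply: measurable_funM.
- by rewrite invr_ge0 ltW.
rewrite ge0_integralD//; last 2 first.
- by move=> x _; rewrite lee_fin mulr_ge0// young_ge0.
- by apply/measurable_EFinP; apply: measurable_funM.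
under eq_integral do rewrite EFinM.
rewrite ge0_integralZl_EFin//; last 2 first.
- by move=> x _; rewrite lee_fin young_ge0.
- exact/measurable_EFinP.
have -> : (\int[@lebesgue_tuple R d]_(x in torus) D%:E =
    (D * (2 * pi) ^+ d)%R%:E)%E.
  rewrite EFinM; apply: (etrans (integral_cst _ mT _)).
  exact: (congr1 (fun z => D%:E * z)%E (@lebesgue_torus R d)).
apply: (@le_trans _ _ ((M^-1)%:E * (C%:E * 1 + (D * (2 * pi) ^+ d)%:E))%E).
  apply: lee_wpmul2l; first by rewrite lee_fin invr_ge0 ltW.
  by apply: leeD => //; apply: lee_wpmul2l => //; rewrite lee_fin.
by rewrite mule1 -EFinD -EFinM lee_fin ler_pdivrMl// /M; lra.
Qed.

Lemma orlicz_growth_gap d r (C V : R) :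
  ~ (@orlicz_space R d Q `<=` @LlogL R d r) -> 0 <= C ->
  exists v, [/\ V <= v, 2 <= v, v <= Q v & C * Q v < v * ln (1 + v) ^+ r].
Proof.
move=> nsub C0; apply: contrapT => nex; apply: nsub.
have [W WQ] := young_ge_id.
apply: (@orlicz_subset_LlogL _ _ C (Num.max (Num.max V 2) W)) => //.
  by rewrite !le_max ler0n orbT.
move=> v; rewrite !ge_max => /andP[/andP[vV v2] vW].
rewrite leNgt; apply/negP => h; apply: nex; exists v; split => //.
  exact: WQ.
by move: h; rewrite /LlogL_young ger0_norm//; lra.
Qed.

End young.

(** * Choice of the heights and of the cubes *)

Section humps.
Context {R : realType}.

Lemma ln_le_log_weight (n : nat) : ln n.+2%:R <= log_weight n :> R.
Proof.
rewrite log_weightE; elim: n => [|n IH].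
  rewrite big_ord_recr big_ord0 /= add0r invr1.
  by have := @le_ln1Dx R 1 _; rewrite -[2%:R]/(1 + 1 : R); apply; lra.
rewrite big_ord_recr /=.
have n0 : (0 : R) < n.+2%:R by rewrite ltr0n.
have -> : n.+3%:R = n.+2%:R * (1 + n.+2%:R^-1) :> R.
  by rewrite mulrDr mulr1 mulfV ?gt_eqF// natr1.
have i0 : 0 < (n.+2%:R^-1 : R) by rewrite invr_gt0.
have i1 : 0 < 1 + (n.+2%:R^-1 : R) by rewrite addr_gt0.
rewrite (lnM n0 i1).
by apply: lerD => //; apply: le_ln1Dx; apply: lt_trans i0; rewrite ltrN10.
Qed.

(** The least N such that A <= N^d; it is at least 2, so that N <= 2 (N - 1). *)
Lemma cube_side (d : nat) (A : R) : (0 < d)%N -> 2 <= A ->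
  exists N, [/\ (2 <= N)%N, A <= N%:R ^+ d & N%:R ^+ d <= 2 ^+ d * A].
Proof.
move=> d0 A2.
have exN : exists n : nat, A <= n%:R ^+ d.
  exists (Num.bound A); have A0 : 0 <= A by lra.
  have Ab := archi_boundP A0.
  apply: le_trans (ltW Ab) _; apply: ler_eXnr => //.
  have A1 : 1 <= A by lra.
  exact: le_trans A1 (ltW Ab).
case: (ex_minnP exN) => N AN Nmin; exists N.
have N2 : (2 <= N)%N.
  rewrite leqNgt; apply/negP => N1; move: AN; rewrite leNgt => /negP; apply.
  apply: lt_le_trans A2; apply: (@le_lt_trans _ _ (1 ^+ d)); last first.
    by rewrite expr1n; lra.
  by apply: lerXn2r; rewrite ?nnegrE// (ler_nat _ _ 1).
split => //.
have N1 : (N.-1)%:R ^+ d < A.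
  rewrite ltNge; apply/negP => /Nmin; lia.
apply: (@le_trans _ _ ((2 * (N.-1)%:R) ^+ d)).
  apply: lerXn2r; rewrite ?nnegrE ?mulr_ge0//.
  by rewrite -natrM ler_nat; lia.
by rewrite exprMn; apply: ler_wpM2l; [rewrite exprn_ge0|exact: ltW].
Qed.

Variables (d : nat) (Q : R -> R) (r : nat).
Hypothesis d0 : (0 < d)%N.
Hypothesis hQ : young_function Q.
Hypothesis hQB : ~ (@orlicz_space R d Q `<=` @LlogL R d r).

(** The contribution of the k-th cube in terms of Q: the choice of N makes l_N at
    least of the order of ln(1+v), and N^d at most of the order of
    2^(k+1) Q(v). *)
Lemma hump_lower (k N : nat) (v : R) :
  2 <= v -> v <= Q v -> 2 ^+ k.+1 * Q v <= N%:R ^+ d ->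
  N%:R ^+ d <= 2 ^+ d * (2 ^+ k.+1 * Q v) ->
  (cos 1 ^+ d * (2 * d%:R) ^- r / 2 / 2 ^+ d / 2 ^+ k.+1) *
    (v * ln (1 + v) ^+ r / Q v) <=
  cos 1 ^+ d * log_weight N ^+ r * (v / 2 / N%:R ^+ d).
Proof.
move=> v2 vQ NQ NQ2; have c1 := cos1_gt0 R.
have dR : (0 : R) < d%:R by rewrite ltr0n.
have Q0 : 0 < Q v by lra.
have k1 : 1 <= (2 : R) ^+ k.+1 by rewrite exprn_ege1//; lra.
have vN : v <= N%:R ^+ d.
  by apply: le_trans vQ (le_trans _ NQ); rewrite ler_peMl// ltW.
have Nd0 : (0 : R) < N%:R ^+ d by lra.
have N0 : (0 < N)%N.
  by case: N Nd0 {NQ NQ2 vN} => //; rewrite expr0n; case: d d0 => //=; rewrite ltxx.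
have NR : (0 : R) < N%:R by rewrite ltr0n.
have lnv : ln (1 + v) <= 2 * d%:R * log_weight N.
  apply: (@le_trans _ _ (2 * ln v)).
    have v0 : 0 < v by lra.
    have v1 : 0 < 1 + v by lra.
    have vv : 1 + v <= v ^+ 2 by nra.
    by rewrite mulr_natl -lnXn// ler_ln ?posrE ?exprn_gt0.
  rewrite -mulrA; apply: ler_wpM2l => //.
  apply: (@le_trans _ _ (ln (N%:R ^+ d))).
    by rewrite ler_ln ?posrE//; lra.
  rewrite lnXn// -[X in X <= _]mulr_natl; apply: ler_wpM2l; first exact: ltW.
  apply: le_trans (ln_le_log_weight N).
  by rewrite ler_ln ?posrE ?ltr0n// ler_nat; lia.
have lnv0 : 0 <= ln (1 + v) by rewrite ln_ge0//; lra.
have lnr : (2 * d%:R) ^- r * ln (1 + v) ^+ r <= log_weight N ^+ r.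
  rewrite -exprVn -exprMn; apply: lerXn2r; rewrite ?nnegrE.
  - by rewrite mulr_ge0// invr_ge0 mulr_ge0// ltW.
  - exact/ltW/log_weight_gt0.
  - by rewrite ler_pdivrMl// mulr_gt0.
have Nd : (2 ^+ d * (2 ^+ k.+1 * Q v))^-1 <= (N%:R ^+ d)^-1.
  by rewrite lef_pV2 ?posrE// !mulr_gt0// ?exprn_gt0.
rewrite [leLHS](_ : _ = cos 1 ^+ d * ((2 * d%:R) ^- r * ln (1 + v) ^+ r) *
   (v / 2 * (2 ^+ d * (2 ^+ k.+1 * Q v))^-1)); last first.
  field.
  by rewrite !gt_eqF ?exprn_gt0 ?mulr_gt0.
have lnr0 : 0 <= (2 * d%:R) ^- r * ln (1 + v) ^+ r.
  by rewrite mulr_ge0 ?exprn_ge0// invr_ge0 exprn_ge0// mulr_ge0// ltW.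
apply: ler_pM.
- by rewrite mulr_ge0 ?exprn_ge0// ltW.
- rewrite mulr_ge0 ?divr_ge0//; first by lra.
  by rewrite invr_ge0 !mulr_ge0 ?exprn_ge0 ?ltW.
- by apply: ler_wpM2l => //; rewrite exprn_ge0 ?ltW.
- by apply: ler_wpM2l => //; rewrite divr_ge0//; lra.
Qed.

(** One step of the choice, with a prescribed contribution X, height at least V
    and N at least 2M. *)
Lemma hump_step (k : nat) (X V : R) (M : nat) : 0 <= X ->
  exists p : R * nat, [/\ [/\ V <= p.1, 2 <= p.1 & p.1 <= Q p.1],
    (2 * M <= p.2)%N, (2 <= p.2)%N, 2 ^+ k.+1 * Q p.1 <= p.2%:R ^+ d &
    X <= cos 1 ^+ d * log_weight p.2 ^+ r * (p.1 / 2 / p.2%:R ^+ d)].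
Proof.
move=> X0; have c1 := cos1_gt0 R.
have dR : (0 : R) < d%:R by rewrite ltr0n.
pose c : R := cos 1 ^+ d * (2 * d%:R) ^- r / 2 / 2 ^+ d / 2 ^+ k.+1.
have c0 : 0 < c.
  by rewrite /c !divr_gt0 ?exprn_gt0 ?mulr_gt0.
have C0 : 0 <= X / c by rewrite divr_ge0// ltW.
have [v [vV v2 vQ gap]] :=
  orlicz_growth_gap hQ (Num.max V ((2 * M)%:R ^+ d)) hQB C0.
move: vV; rewrite ge_max => /andP[vV vM].
have Q0 : 0 < Q v by lra.
have k1 : 2 <= (2 : R) ^+ k.+1 by rewrite exprS ler_peMr// exprn_ege1//; lra.
have A2 : 2 <= 2 ^+ k.+1 * Q v by nra.
have [N [N2 AN NA]] := cube_side d0 A2.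
exists (v, N); split => //=.
  have : (2 * M)%:R ^+ d <= N%:R ^+ d :> R.
    by apply: le_trans vM (le_trans vQ (le_trans _ AN)); rewrite ler_peMl//; lra.
  by rewrite ler_pXn2r ?nnegrE// ler_nat.
apply: le_trans (hump_lower v2 vQ AN NA); rewrite -/c.
by rewrite -ler_pdivrMl// mulrC ler_pdivlMr// ltW.
Qed.

(** The successive choices; Y is the unit in which the growth of the means is
    measured, and L the L_1 bound of the dual kernel, which multiplies the
    preceding height (0 for k = 0). *)
Lemma hump_sequence (Y : R) (L : R) : 0 <= Y -> 0 <= L ->
  exists v N, forall k : nat,
   [/\ [/\ 2 <= v k, v k <= Q (v k) & v k <= v k.+1],
    (2 * N k <= N k.+1)%N, (2 <= N k)%N, 2 ^+ k.+1 * Q (v k) <= (N k)%:R ^+ d &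
    k%:R * Y + L * (if k is j.+1 then v j else 0) <=
    cos 1 ^+ d * log_weight (N k) ^+ r * (v k / 2 / (N k)%:R ^+ d)].
Proof.
move=> Y0 L0.
have /choice[nx nxP] : forall a : nat * (R * nat), exists p : R * nat, 0 <= a.2.1 ->
    [/\ [/\ a.2.1 <= p.1, 2 <= p.1 & p.1 <= Q p.1],
    (2 * a.2.2 <= p.2)%N, (2 <= p.2)%N, 2 ^+ a.1.+1 * Q p.1 <= p.2%:R ^+ d &
    a.1%:R * Y + L * a.2.1 <=
    cos 1 ^+ d * log_weight p.2 ^+ r * (p.1 / 2 / p.2%:R ^+ d)].
  move=> [k [V M]] /=; have [V0|V0] := leP 0 V; last first.
    by exists (0, 0%N).
  have [|p pP] := @hump_step k (k%:R * Y + L * V) V M.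
    by rewrite addr_ge0 ?mulr_ge0.
  by exists p.
(* The k-th choice is made from the preceding one, or from (0, 0) if k = 0. *)
pose s := fix s k : R * nat := nx (k, if k is j.+1 then s j else (0, 0%N)).
pose prev k : R * nat := if k is j.+1 then s j else (0, 0%N).
have sE k : s k = nx (k, prev k) by case: k.
have prev0 k : 0 <= (prev k).1.
  elim: k => [|k IH] //=; rewrite sE.
  by have [[_ h _] _ _ _ _] := nxP (k, prev k) IH; lra.
have sP k := nxP (k, prev k) (prev0 k).
exists (fst \o s), (snd \o s) => k /=.
have := sP k.+1; rewrite -sE /= => -[[vv _ _] NN _ _ _].
have := sP k; rewrite -sE /= => -[[_ v2 vQ] _ N2 NQ H].
by split => //; case: k vv NN v2 vQ N2 NQ H.
Qed.

End humps.

(** * Functions with countably many values *)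

Section step_functions.
Context d (T : measurableType d) (R : realType).
Variables (A : nat -> set T).
Hypothesis mA : forall k, measurable (A k).
Hypothesis tA : trivIset setT A.

(** The function equal to v k on A k and to 0 outside the union of the A k; the
    formula has this meaning when the A k are pairwise disjoint. *)
Definition step_fun (v : nat -> R) (x : T) : R :=
  fine (\sum_(k <oo) (v k * \1_(A k) x)%:E).

Lemma step_series_on (v : nat -> R) (k : nat) (x : T) : (forall i, 0 <= v i) ->
  A k x -> (\sum_(i <oo) (v i * \1_(A i) x)%:E = (v k)%:E)%E.
Proof.
move=> v0 Ax; rewrite (nneseriesD1 (n := k))//; last first.
  by move=> i _; rewrite lee_fin mulr_ge0.
rewrite indicE mem_set// mulr1 eseries0 ?adde0// => i _ /= ik.
rewrite indicE memNset ?mulr0// => Ai.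
by move/eqP : ik; apply; apply: (tA (i := i) (j := k)) => //; exists x.
Qed.

Lemma step_series_off (v : nat -> R) (x : T) : (forall k, ~ A k x) ->
  (\sum_(i <oo) (v i * \1_(A i) x)%:E = 0)%E.
Proof.
move=> nA; apply: eseries0 => i _ _.
by rewrite indicE memNset ?mulr0//; exact: nA.
Qed.

Lemma step_fun_on (v : nat -> R) (k : nat) (x : T) : (forall i, 0 <= v i) ->
  A k x -> step_fun v x = v k.
Proof. by move=> v0 Ax; rewrite /step_fun (step_series_on v0 Ax). Qed.

Lemma step_fun_off (v : nat -> R) (x : T) :
  (forall k, ~ A k x) -> step_fun v x = 0.
Proof. by move=> nA; rewrite /step_fun step_series_off. Qed.

Lemma step_fun_comp (Q : R -> R) (v : nat -> R) (x : T) :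
  Q 0 = 0 -> (forall i, 0 <= v i) -> (forall i, 0 <= Q (v i)) ->
  ((Q (step_fun v x))%:E = \sum_(i <oo) (Q (v i) * \1_(A i) x)%:E)%E.
Proof.
move=> Q0 v0 Qv0; have [[k Ax]|nA] := pselect (exists k, A k x).
  by rewrite (step_fun_on v0 Ax) (step_series_on (v := Q \o v) Qv0 Ax).
have nA' k : ~ A k x by move=> Ax; apply: nA; exists k.
by rewrite step_fun_off// (step_series_off (Q \o v))// Q0.
Qed.

Lemma measurable_step_fun (v : nat -> R) :
  (forall i, 0 <= v i) -> measurable_fun setT (step_fun v).
Proof.
move=> v0; apply: measurableT_comp; first exact: fine_measurable.
apply: ge0_emeasurable_sum => [k x _ _|k _]; first by rewrite lee_fin mulr_ge0.
by apply/measurable_EFinP; apply: measurable_funM.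
Qed.

Lemma integral_step_fun_comp (mu : {measure set T -> \bar R}) (D : set T)
    (Q : R -> R) (v : nat -> R) :
  measurable D -> (forall i, A i `<=` D) ->
  Q 0 = 0 -> (forall i, 0 <= v i) -> (forall i, 0 <= Q (v i)) ->
  (\int[mu]_(x in D) (Q (step_fun v x))%:E =
   \sum_(i <oo) (Q (v i))%:E * mu (A i))%E.
Proof.
move=> mD AD Q0 v0 Qv0.
under eq_integral do rewrite step_fun_comp//.
rewrite integral_nneseries//; last 2 first.
- by move=> k; apply/measurable_EFinP; apply: measurable_funM.
- by move=> k x _; rewrite lee_fin mulr_ge0.
apply: eq_eseriesr => k _; under eq_integral do rewrite EFinM.
rewrite ge0_integralZl_EFin//; last by apply/measurable_EFinP.
by rewrite integral_indic// setIidl.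
Qed.

End step_functions.

(** * Cubes at the corner of the torus *)

Section nested_cubes.
Context {R : realType} {d : nat}.
Local Notation mut := (@lebesgue_tuple R d).

(** The cube of side 1/N at the corner (-pi, ..., -pi) of the torus. *)
Definition corner_cube (N : nat) : set (d.-tuple R) :=
  [set x | forall j, tnth x j \in `[- pi, - pi + N%:R^-1[].

Lemma measurable_corner_cube (N : nat) : measurable (corner_cube N).
Proof.
apply: (@measurable_box R d (fun=> `[- pi, - pi + N%:R^-1[%classic)) => j.
exact: measurable_itv.
Qed.

Lemma lebesgue_corner_cube (N : nat) :
  mut (corner_cube N) = ((N%:R^-1) ^+ d)%:E.
Proof.
pose I : set (measurableTypeR R) := `[- pi, - pi + N%:R^-1[%classic.
rewrite -[corner_cube N]/([set x : d.-tuple R | forall j, I (tnth x j)]).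
rewrite (lebesgue_tuple_box (A := fun=> I)); last first.
  by move=> j; exact: measurable_itv.
rewrite (eq_bigr (fun=> (N%:R^-1)%:E)); last first.
  move=> j _; rewrite /I lebesgue_measure_itv /= lte_fin.
  case: ifPn => h; first by rewrite -EFinB; congr EFin; ring.
  have n0 : 0 <= (N%:R^-1 : R) by rewrite invr_ge0.
  by congr EFin; move: h; rewrite -leNgt; lra.
by rewrite prodEFin prodr_const card_ord.
Qed.

Lemma sub_corner_cube (M N : nat) : (0 < M)%N -> (M <= N)%N ->
  corner_cube N `<=` corner_cube M.
Proof.
move=> M0 MN x Nx j; have := Nx j; rewrite !in_itv /= => /andP[-> h] /=.
apply: lt_le_trans h _; rewrite lerD2l lef_pV2 ?posrE ?ltr0n//.
  by rewrite ler_nat.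
exact: leq_trans MN.
Qed.

Lemma corner_cube_sub_torus (N : nat) : (0 < N)%N -> corner_cube N `<=` torus.
Proof.
move=> N0 x Nx j; have := Nx j; rewrite !in_itv /= => /andP[-> h] /=.
apply: lt_le_trans h _; have p2 := pi_ge2 R.
have : (N%:R^-1 : R) <= 1 by rewrite invf_le1 ?ltr0n// ler1n.
by set z := _^-1; clearbody z; lra.
Qed.

Lemma mixed_dual_ge (B : {set 'I_d}) (n : nat) (x : d.-tuple R) : (0 < n)%N ->
  corner_cube n x ->
  cos 1 ^+ d * log_weight n ^+ #|B| <= mixed_dual B n x.
Proof.
move=> n0 nx; have c1 := cos1_gt0 R.
have l0 : 0 < log_weight n :> R by exact: log_weight_gt0.
rewrite (_ : _ * _ = \prod_(j < d)
    (cos 1 * (if j \in B then log_weight n else 1))); last first.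
  rewrite big_split /= prodr_const card_ord; congr (_ * _).
  by rewrite -big_mkcond /= prodr_const.
apply: ler_prod => j _; apply/andP; split.
  by rewrite mulr_ge0 ?(ltW c1)//; case: ifP => // _; exact: ltW.
have := nx j; rewrite in_itv /= => /andP[h1 h2].
apply: dual_kernel_ge => //.
by rewrite mulrC -ler_pdivlMr ?ltr0n// mul1r -lerBrDr; lra.
Qed.

Lemma integral_norm_mixed_dual (B : {set 'I_d}) (n : nat) :
  \int[mut]_(x in torus) `|mixed_dual B n x| <= (9 * pi ^+ 2) ^+ d.
Proof.
under eq_Rintegral do rewrite normr_prod.
rewrite (@integral_torus_prod R d (fun j t => `|dual_kernel (j \in B) n t|)
   (pi * n.*2.+1%:R * (2 * pi))); last 2 first.
- move=> j; apply: continuous_measurable_fun; apply: continuous_normr.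
  exact: continuous_dual_kernel.
- by move=> j t _; rewrite normr_id; exact: norm_dual_kernel_le.
rewrite -[d in leRHS]card_ord -prodr_const; apply: ler_prod => j _.
by rewrite Rintegral_ge0//= integral_norm_dual_kernel.
Qed.

End nested_cubes.

(** * The resonating function *)

Section resonance.
Context {R : realType} {d : nat}.
Variables (B : {set 'I_d}) (Q : R -> R) (v : nat -> R) (N : nat -> nat).
Hypothesis d0 : (0 < d)%N.
Hypothesis hQ : young_function Q.
Hypothesis v2 : forall k, 2 <= v k.
Hypothesis vQ : forall k, v k <= Q (v k).
Hypothesis vS : forall k, v k <= v k.+1.
Hypothesis NS : forall k, (2 * N k <= N k.+1)%N.
Hypothesis N2 : forall k, (2 <= N k)%N.
Hypothesis NQ : forall k, 2 ^+ k.+1 * Q (v k) <= (N k)%:R ^+ d.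
Hypothesis vN : forall k,
  k%:R * ((2 * pi) ^+ d * pi ^+ d) +
    (9 * pi ^+ 2) ^+ d * (if k is j.+1 then v j else 0) <=
  cos 1 ^+ d * log_weight (N k) ^+ #|B| * (v k / 2 / (N k)%:R ^+ d).
Local Notation mut := (@lebesgue_tuple R d).

Let A k : set (d.-tuple R) := corner_cube (N k) `\` corner_cube (N k.+1).

(** The function whose means are unbounded: v k on the k-th cube minus the next
    one. *)
Definition resonator : d.-tuple R -> R := step_fun A v.

Let N0 k : (0 < N k)%N. Proof. exact: leq_trans (N2 k). Qed.

Let N_homo i j : (i <= j)%N -> (N i <= N j)%N.
Proof.
have NS' k : (N k <= N k.+1)%N by have := NS k; lia.
by move: i j; exact: (@homo_leq _ N leq leqnn (fun y x z => @leq_trans y x z) NS').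
Qed.

Let v_homo i j : (i <= j)%N -> v i <= v j.
Proof.
move: i j.
exact: (@homo_leq _ v <=%R (@lexx _ _) (fun y x z => @le_trans _ _ y x z) vS).
Qed.

Let v0 k : 0 <= v k. Proof. by have := v2 k; lra. Qed.

Let Qv0 k : 0 <= Q (v k). Proof. exact: young_ge0. Qed.

Let subE i j : (i <= j)%N -> @corner_cube R d (N j) `<=` corner_cube (N i).
Proof. by move=> ij; exact: sub_corner_cube (N0 i) (N_homo ij). Qed.

Let mA k : measurable (A k).
Proof. by apply: measurableD; exact: measurable_corner_cube. Qed.

Let tA : trivIset setT A.
Proof.
move=> i j _ _ [x [[Ei nEi] [Ej nEj]]].
by case: (ltngtP i j) => // ij;
  [case: nEi; exact: subE ij _ Ej|case: nEj; exact: subE ij _ Ei].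
Qed.

Let A_sub_torus k : A k `<=` torus.
Proof. by move=> x [Ex _]; exact: corner_cube_sub_torus (N0 k) _ Ex. Qed.

Let mT := @measurable_torus R d.

Lemma resonator_on k x : A k x -> resonator x = v k.
Proof. exact: step_fun_on. Qed.

Lemma resonator_off x : (forall k, ~ A k x) -> resonator x = 0.
Proof. exact: step_fun_off. Qed.

Lemma resonator_cases x : (exists2 k, A k x & resonator x = v k) \/ resonator x = 0.
Proof.
have [[k Ax]|nA] := pselect (exists k, A k x).
  by left; exists k => //; exact: resonator_on.
by right; apply: resonator_off => k Ax; apply: nA; exists k.
Qed.

Lemma resonator_ge0 x : 0 <= resonator x.
Proof. by case: (resonator_cases x) => [[k _ ->]|->]. Qed.

Lemma measurable_resonator : measurable_fun setT resonator.
Proof. exact: measurable_step_fun. Qed.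

Lemma lebesgue_cell_le k : (mut (A k) <= ((N k)%:R ^- d)%:E)%E.
Proof.
rewrite -exprVn -lebesgue_corner_cube; apply: le_measure; rewrite ?inE.
- exact: mA.
- exact: measurable_corner_cube.
- exact: subDsetl.
Qed.

(** The k-th value contributes at most 2^-(k+1). *)
Lemma integral_young_resonator :
  (\int[mut]_(x in torus) (Q (resonator x))%:E <= 1)%E.
Proof.
rewrite (integral_step_fun_comp mA tA mut mT A_sub_torus (young0 hQ) v0 Qv0).
apply: (@le_trans _ _ (\sum_(k <oo) (1 / (2 ^ k.+1)%:R)%:E)%E); last first.
  by apply: epsilon_trick0.
apply: lee_nneseries.
  by move=> i _ _; apply: mule_ge0; rewrite ?lee_fin// measure_ge0.
move=> k _; apply: (@le_trans _ _ ((Q (v k))%:E * ((N k)%:R ^- d)%:E)%E).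
  by apply: lee_wpmul2l; [rewrite lee_fin|exact: lebesgue_cell_le].
have p0 : (0 : R) < 2 ^+ k.+1 by rewrite exprn_gt0.
have n0 : (0 : R) < (N k)%:R ^+ d by rewrite exprn_gt0// ltr0n.
rewrite -EFinM lee_fin natrX ler_pdivrMr// mulrC mul1r.
by rewrite ler_pdivlMr// mulrC.
Qed.

Lemma le_young_resonator x : resonator x <= Q (resonator x).
Proof.
by case: (resonator_cases x) => [[k _ ->]|->]; [exact: vQ|rewrite (young0 hQ)].
Qed.

Lemma integral_resonator_le1 : (\int[mut]_(x in torus) (resonator x)%:E <= 1)%E.
Proof.
apply: le_trans integral_young_resonator; apply: ge0_le_integral => //.
- by move=> x _; rewrite lee_fin resonator_ge0.
- by apply/measurable_EFinP; apply: measurable_funTS; exact: measurable_resonator.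
- apply/measurable_EFinP; apply: measurable_funTS.
  exact: measurableT_comp (measurable_young hQ) measurable_resonator.
- by move=> x _; rewrite lee_fin le_young_resonator.
Qed.

Lemma integrable_resonator : mut.-integrable torus (EFin \o resonator).
Proof.
apply/integrableP; split.
  by apply/measurable_EFinP; apply: measurable_funTS; exact: measurable_resonator.
apply: (@le_lt_trans _ _ 1%E); last exact: ltry.
under eq_integral do rewrite /= ger0_norm ?resonator_ge0//.
exact: integral_resonator_le1.
Qed.

(** The k-th cell keeps at least half of the measure of its cube, since the next
    side is at most half as large and d > 0. *)
Lemma lebesgue_cell_ge k : (N k)%:R ^- d / 2 <= fine (mut (A k)).
Proof.
have EE : corner_cube (N k) `&` corner_cube (N k.+1) = @corner_cube R d (N k.+1).
  by apply/setIidPr; apply: subE.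
have -> : mut (A k) = ((N k)%:R^-1 ^+ d - (N k.+1)%:R^-1 ^+ d)%:E.
  rewrite EFinB -!lebesgue_corner_cube -EE; apply: measureD.
  - exact: measurable_corner_cube.
  - exact: measurable_corner_cube.
  - apply: (@le_lt_trans _ _ ((N k)%:R^-1 ^+ d)%:E); last exact: ltry.
    by rewrite -lebesgue_corner_cube.
rewrite /= exprVn.
have n0 : (0 : R) < (N k)%:R by rewrite ltr0n.
suff : (N k.+1)%:R^-1 ^+ d <= (N k)%:R ^- d / 2 :> R.
  by set X := _ ^- d; set Y := _ ^+ d; clearbody X Y; lra.
apply: (@le_trans _ _ ((2 * (N k)%:R)^-1 ^+ d)).
  apply: lerXn2r; rewrite ?nnegrE ?invr_ge0 ?mulr_ge0//.
  by rewrite lef_pV2 ?posrE ?ltr0n// ?mulr_gt0// -natrM ler_nat.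
rewrite invfM exprMn mulrC !exprVn; apply: ler_wpM2l.
  by rewrite invr_ge0 exprn_ge0.
case: d d0 => // e _; rewrite lef_pV2 ?posrE ?exprn_gt0//.
by rewrite exprS ler_peMr// exprn_ege1//; lra.
Qed.

Lemma resonator_le_outside k x : ~ corner_cube (N k) x ->
  resonator x <= if k is j.+1 then v j else 0.
Proof.
move=> nE; case: (resonator_cases x) => [[i [Ei _] ->]|->]; last by case: k nE.
case: k nE => [|j] nE; first by case: nE; exact: (subE (leq0n i) Ei).
apply: v_homo; rewrite leqNgt; apply/negP => ji; apply: nE.
exact: (subE ji Ei).
Qed.

(** The function f K_(N_k) is at least c v_k on the k-th cell, nonnegative on the
    rest of the k-th cube, and at least - v_(k-1) |K_(N_k)| elsewhere. *)
Lemma integral_resonator_dual k :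
  k%:R * ((2 * pi) ^+ d * pi ^+ d) <=
  \int[mut]_(x in torus) (resonator x * mixed_dual B (N k) x).
Proof.
pose c : R := cos 1 ^+ d * log_weight (N k) ^+ #|B|.
pose V : R := if k is j.+1 then v j else 0.
pose D := @mixed_dual R d B (N k).
have c0 : 0 <= c.
  rewrite mulr_ge0 ?exprn_ge0 ?(ltW (cos1_gt0 R))//.
  exact/ltW/log_weight_gt0.
have V0 : 0 <= V by rewrite /V; case: k {c c0 V D}.
have cv0 : 0 <= c * v k by rewrite mulr_ge0.
have i1 : mut.-integrable torus (EFin \o (fun x => c * v k * \1_(A k) x)).
  apply: (@bounded_integrable _ _ _ _ _ _ (c * v k)) => //.
  - exact: lebesgue_torus_fin.
  - by apply: measurable_funM.
  - move=> x _; rewrite indicE.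
    by case: (_ \in _); rewrite ?mulr1 ?mulr0 ?normr0 ?ger0_norm.
have mD : measurable_fun torus D.
  by apply: measurable_funTS; exact: measurable_mixed_dual.
have iN : mut.-integrable torus (EFin \o (fun x => `|D x|)).
  apply: (@bounded_integrable _ _ _ _ _ _
    ((pi * (N k).*2.+1%:R * (2 * pi)) ^+ d)) => //.
  - exact: lebesgue_torus_fin.
  - exact: measurableT_comp.
  - move=> x Tx; rewrite normr_id; move: Tx.
    apply: (@norm_prod_tnth_le R d (fun j => dual_kernel (j \in B) (N k))) => j t _.
    exact: norm_dual_kernel_le.
have iV : mut.-integrable torus (EFin \o (fun x => V * `|D x|)).
  exact: (integrableZl mT _ iN).
apply: (@le_trans _ _ (\int[mut]_(x in torus)
    (c * v k * \1_(A k) x - V * `|D x|))); last first.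
  apply: le_Rintegral => //.
  - exact: (integrableB mT i1 iV).
  - exact: integrable_mul_dual integrable_resonator.
  - move=> x Tx; rewrite -/(D x) indicE.
    have VD : 0 <= V * `|D x| by rewrite mulr_ge0.
    have [Ax|nAx] := boolP (x \in A k).
      have Ax' := set_mem Ax; rewrite mulr1 (resonator_on Ax').
      have := mixed_dual_ge B (N0 k) Ax'.1; rewrite -/c -/D => h.
      apply: (@le_trans _ _ (c * v k)); first by rewrite gerBl.
      by rewrite mulrC; apply: ler_wpM2l.
    rewrite mulr0 sub0r; have [Ex|nEx] := pselect (corner_cube (N k) x).
      have := mixed_dual_ge B (N0 k) Ex; rewrite -/c -/D => h.
      apply: (@le_trans _ _ 0); first by rewrite oppr_le0.
      by rewrite mulr_ge0 ?resonator_ge0// (le_trans c0).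
    rewrite lerNl -mulrN; apply: le_trans (ler_norm _) _.
    rewrite normrM normrN (ger0_norm (resonator_ge0 _)).
    by apply: ler_wpM2r => //; exact: resonator_le_outside.
have i1' : mut.-integrable torus (EFin \o \1_(A k)).
  apply: (@bounded_integrable _ _ _ _ _ _ 1) => //.
  - exact: lebesgue_torus_fin.
  - by move=> x _; rewrite indicE; case: (_ \in _); rewrite ?normr1 ?normr0.
rewrite RintegralB// RintegralZl//.
rewrite [X in _ <= _ - X]RintegralZl//.
have -> : \int[mut]_(x in torus) \1_(A k) x = fine (mut (A k)) :> R.
  by rewrite /Rintegral integral_indic// setIidl.
have vNk := vN k; rewrite -/c -/V in vNk.
have h1 : c * (v k / 2 / (N k)%:R ^+ d) <= c * v k * fine (mut (A k)).
  rewrite (_ : _ * (_ / _) = c * v k * ((N k)%:R ^- d / 2)); last by ring.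
  by apply: ler_wpM2l => //; exact: lebesgue_cell_ge.
have h2 : V * \int[mut]_(x in torus) `|D x| <= (9 * pi ^+ 2) ^+ d * V.
  by rewrite mulrC; apply: ler_wpM2r => //; exact: integral_norm_mixed_dual.
move: vNk h1 h2; set a := k%:R * _; set b := c * (_ / _); set e := c * _ * _.
by set f := V * _; set h := _ ^+ d * V; clearbody a b e f h; lra.
Qed.

Lemma norm_L1_resonator_ge k :
  (k%:R%:E <= norm_L1 (diag_log_mean B (N k) (fun x => (resonator x)%:C)))%E.
Proof.
have p0 := pi_gt0 R.
have pd0 : 0 < (pi : R) ^+ d by rewrite exprn_gt0.
have qd0 : 0 < (2 * pi : R) ^+ d by rewrite exprn_gt0// mulr_gt0.
rewrite -(@lee_pmul2l _ (pi ^+ d)%:E)// ?lte_fin//.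
apply: le_trans (norm_L1_log_mean_ge B (N k) integrable_resonator).
rewrite -EFinM lee_fin mulrC ler_pdivlMl//.
apply: le_trans (le_trans (integral_resonator_dual k) (ler_norm _)).
by rewrite le_eqVlt; apply/orP; left; apply/eqP; ring.
Qed.

End resonance.

Theorem theorem3 (R : realType) (d : nat) (hd : (1 <= d)%N)
    (B : {set 'I_d}) (hB : B != finset.set0)
    (Q : R -> R) (hQ : young_function Q)
    (hQB : ~ (@orlicz_space R d Q `<=` @LlogL R d #|B|)) :
  ereal_sup (range (fun n : nat =>
    operator_norm Q (@diag_log_mean R d B n))) = +oo%E
  /\
  exists f : d.-tuple R -> R[i], orlicz_space Q f /\
    ~ (norm_L1 (fun x => diag_log_mean B n f x - f x) @[n --> \oo] --> 0%E).
Proof.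
have Y0 : 0 <= (2 * pi) ^+ d * pi ^+ d :> R.
  by rewrite mulr_ge0 ?exprn_ge0 ?mulr_ge0 ?pi_ge0.
have L0 : 0 <= (9 * pi ^+ 2) ^+ d :> R by rewrite exprn_ge0// mulr_ge0// sqr_ge0.
(* The unit (2 pi)^d pi^d is the product of the constants in
   norm_L1_log_mean_ge, and (9 pi^2)^d is the bound of
   integral_norm_mixed_dual. *)
have [v [N vN]] := hump_sequence hd hQ hQB Y0 L0.
have v2 k : 2 <= v k by have [[]] := vN k.
have vQ k : v k <= Q (v k) by have [[]] := vN k.
have vS k : v k <= v k.+1 by have [[]] := vN k.
have NS k : (2 * N k <= N k.+1)%N by have [] := vN k.
have N2 k : (2 <= N k)%N by have [] := vN k.
have NQ k : 2 ^+ k.+1 * Q (v k) <= (N k)%:R ^+ d by have [] := vN k.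
have vNk k := let: And5 _ _ _ _ h := vN k in h.
pose g := @resonator R d v N.
pose f x := (g x)%:C.
have g0 x : 0 <= g x by exact: resonator_ge0.
have mg : measurable_fun setT g by exact: measurable_resonator.
have nf x : ComplexField.Normc.normc (f x) = g x.
  by rewrite complex_normcE /= expr0n addr0 sqrtr_sqr ger0_norm.
have big k : (k%:R%:E <= norm_L1 (diag_log_mean B (N k) f))%E.
  exact: (norm_L1_resonator_ge hd hQ v2 vQ vS NS N2 NQ vNk).
have f1 : (orlicz_norm Q f <= 1)%E.
  apply: ereal_inf_lbound; exists 1 => //; split => //.
  under eq_integral do rewrite nf divr1.
  exact: integral_young_resonator.
have fQ : orlicz_space Q f.
  split; last exact: le_lt_trans f1 (ltry _).
  by split; apply: measurable_funTS.
split.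
  apply/eqyP => a a0; apply: (@le_trans _ _ (Num.bound a)%:R%:E).
    by rewrite lee_fin ltW// archi_boundP// ltW.
  apply: le_trans (big _) _; apply: (@le_trans _ _
      (operator_norm Q (@diag_log_mean R d B (N (Num.bound a))))).
    by apply: ereal_sup_ubound; exists f.
  by apply: ereal_sup_ubound; exists (N (Num.bound a)).
exists f; split => // cv.
(* Convergence would bound the means of f by 1 + 1 from some order on. *)
have [M _ MP] := cv _ (open_ereal_lt' (@lte01 R)).
pose k := maxn M 3.
have Nk j : (j <= N j)%N.
  elim: j => // j IH; have := NS j; have := N2 j; lia.
have small : (norm_L1 (fun x => (diag_log_mean B (N k) f x - f x)%R) < 1)%E.
  by apply: MP; apply: leq_trans (Nk k); exact: leq_maxl.
have f1' : (norm_L1 f <= 1)%E.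
  rewrite /norm_L1; under eq_integral do rewrite nf.
  exact: (integral_resonator_le1 (Q := Q)).
have mT := @measurable_torus R d.
have [mRe mIm] := measurable_log_mean B (N k) f.
have mdiff : measurable_fun torus (fun x =>
    ComplexField.Normc.normc (diag_log_mean B (N k) f x - f x)).
  apply: measurable_normc.
    rewrite (_ : (fun _ => _) = fun x =>
        complex.Re (diag_log_mean B (N k) f x) - g x); last first.
      by apply/funext => x; case: (diag_log_mean _ _ _ _).
    by apply: measurable_funB; apply: measurable_funTS.
  rewrite (_ : (fun _ => _) =
      fun x => complex.Im (diag_log_mean B (N k) f x)); last first.
    by apply/funext => x; case: (diag_log_mean _ _ _ _) => a b /=; rewrite subr0.
  exact: measurable_funTS.
have : (norm_L1 (diag_log_mean B (N k) f) <= 1 + 1)%E.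
  apply: le_trans (leeD (ltW small) f1'); rewrite /norm_L1 -ge0_integralD//.
  - apply: ge0_le_integral => //.
    + by move=> x _; rewrite lee_fin complex_normc_ge0.
    + by apply/measurable_EFinP; apply: measurable_normc; apply: measurable_funTS.
    + apply: emeasurable_funD; apply/measurable_EFinP => //.
      by under eq_fun do rewrite nf; apply: measurable_funTS.
    + move=> x _; rewrite -EFinD lee_fin.
      rewrite -[in leLHS](subrK (f x) (diag_log_mean B (N k) f x)).
      exact: (@le_normcD R).
  - by move=> x _; rewrite lee_fin complex_normc_ge0.
  - by apply/measurable_EFinP.
  - by move=> x _; rewrite lee_fin complex_normc_ge0.
  - by apply/measurable_EFinP; under eq_fun do rewrite nf; apply: measurable_funTS.
move=> /(le_trans (big k)); rewrite -EFinD lee_fin -[leRHS]/(2%:R) ler_nat => k2.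
by have := leq_trans (leq_maxr M 3) k2.
Qed.
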